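(* Suppose that $h(X)$ is convex, that $\mathcal{Q}(G)$ is Archimedean, and that the Slater condition holds for the problem $(P_h)$. Then $h^{\mathrm{sos}}_k$ decreasingly converges to $h^*$ as $k\to\infty$ (that is, the sequence $(h^{\mathrm{sos}}_k)_{k\ge d_P}$ is non-increasing and has limit $h^*$).
   Context: Notation: $\mathbb{R}[X]=\mathbb{R}[X_1,\dots,X_m]$, $\mathbb{R}[Y]=\mathbb{R}[Y_1,\dots,Y_n]$, and $\Sigma^2[Y]$ is the set of polynomials in $\mathbb{R}[Y]$ that are finite sums of squares of polynomials. Let $h(X)\in\mathbb{R}[X]$, $a(Y)=(a_1(Y),\dots,a_m(Y))^T\in\mathbb{R}[Y]^m$, $b(Y)\in\mathbb{R}[Y]$, $G=\{g_1,\dots,g_s\}\subset\mathbb{R}[Y]$, and $S=\{y\in\mathbb{R}^n : g_1(y)\ge0,\dots,g_s(y)\ge0\}$. Consider $$(P_h)\qquad h^*:=\inf_{x\in\mathbb{R}^m} h(x)\quad\text{s.t.}\quad a(y)^Tx+b(y)\ge0\ \ \forall y\in S.$$ Quadratic module: $\mathcal{Q}(G)=\{\sum_{j=0}^s\sigma_jg_j : g_0=1,\ \sigma_j\in\Sigma^2[Y]\}$; truncation: $\mathcal{Q}_k(G)=\{\sum_{j=0}^s\sigma_jg_j : g_0=1,\ \sigma_j\in\Sigma^2[Y],\ \deg(\sigma_jg_j)\le 2k\}$. $\mathcal{Q}(G)$ is Archimedean if there is $\psi\in\mathcal{Q}(G)$ such that $\{y\in\mathbb{R}^n:\psi(y)\ge0\}$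 is compact. The Slater condition holds for $(P_h)$ if there is $\bar x\in\mathbb{R}^m$ with $a(y)^T\bar x+b(y)>0$ for all $y\in S$. Let $d_j=\lceil\deg(g_j)/2\rceil$, $d_S=\max\{1,d_1,\dots,d_s\}$, $d_P=\max\{d_S,\lceil\deg(a_1)/2\rceil,\dots,\lceil\deg(a_m)/2\rceil,\lceil\deg(b)/2\rceil\}$. For integers $k\ge d_P$, $$h^{\mathrm{sos}}_k:=\inf\{h(x) : x\in\mathbb{R}^m,\ a(Y)^Tx+b(Y)\in\mathcal{Q}_k(G)\},$$ with the infimum over the empty set equal to $+\infty$. *)

(* Defs.v *)
From HB Require Import structures.
From mathcomp Require Import all_boot all_order all_algebra.
From mathcomp Require Import all_classical all_reals.
From mathcomp Require Import ereal topology normedtype sequences convex.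
(* The notations of mpoly clash with those of MathComp-Analysis. *)
From mathcomp Require Import -(notations) mpoly.

Set Implicit Arguments.
Unset Strict Implicit.
Unset Printing Implicit Defensive.

Import Order.TTheory GRing.Theory Num.Theory.
Import numFieldNormedType.Exports.

Local Open Scope classical_set_scope.
Local Open Scope ring_scope.

Notation "{ 'mpoly' R [ n ] }" := (mpoly n R)
  (format "{ 'mpoly'  R [ n ] }") : type_scope.

Section Polynomials.
Variables (R : realType) (n : nat).
Implicit Types (p : {mpoly R[n]}) (y : 'rV[R]_n).

Definition peval p y : R := meval (fun i => y ord0 i) p.

(* The zero polynomial gets degree 0 rather than -oo; this changes neither an
   upper bound on a degree nor a maximum of degrees. *)
Definition pdeg p : nat := (mmeasure mdeg p).-1.

(* ceil(deg p / 2) *)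
Definition half_deg p : nat := uphalf (pdeg p).

Definition is_sos p : Prop :=
  exists qs : seq {mpoly R[n]}, p = \sum_(q <- qs) q ^+ 2.

End Polynomials.

Section QuadraticModule.
Variables (R : realType) (n s : nat) (g : 'I_s -> {mpoly R[n]}).

Definition semialg : set 'rV[R]_n := [set y | forall j, 0 <= peval (g j) y].

(* The summand with g_0 = 1 is written separately as sigma0. *)
Definition quad_module : set {mpoly R[n]} :=
  [set p | exists (sigma0 : {mpoly R[n]}) (sigma : 'I_s -> {mpoly R[n]}),
    [/\ is_sos sigma0, (forall j, is_sos (sigma j))
      & p = sigma0 + \sum_(j < s) sigma j * g j]].

Definition trunc_quad_module (k : nat) : set {mpoly R[n]} :=
  [set p | exists (sigma0 : {mpoly R[n]}) (sigma : 'I_s -> {mpoly R[n]}),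
    [/\ is_sos sigma0 /\ (pdeg sigma0 <= k.*2)%N,
        (forall j, is_sos (sigma j) /\ (pdeg (sigma j * g j)%R <= k.*2)%N)
      & p = sigma0 + \sum_(j < s) sigma j * g j]].

Definition archimedean_module : Prop :=
  exists2 psi, quad_module psi & compact [set y : 'rV[R]_n | 0 <= peval psi y].

End QuadraticModule.

Section Problem.
Variables (R : realType) (m n s : nat).
Variables (h : {mpoly R[m]}) (a : 'I_m -> {mpoly R[n]}) (b : {mpoly R[n]}).
Variable g : 'I_s -> {mpoly R[n]}.

(* The polynomial a(Y)^T x + b(Y) in Y. *)
Definition constraint_poly (x : 'rV[R]_m) : {mpoly R[n]} :=
  \sum_(i < m) x ord0 i *: a i + b.

Definition constraint_val (x : 'rV[R]_m) (y : 'rV[R]_n) : R :=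
  \sum_(i < m) peval (a i) y * x ord0 i + peval b y.

Definition feasible : set 'rV[R]_m :=
  [set x | forall y, semialg g y -> 0 <= constraint_val x y].

Definition h_star : \bar R := ereal_inf [set (peval h x)%:E | x in feasible].

Definition slater : Prop :=
  exists xbar : 'rV[R]_m, forall y, semialg g y -> 0 < constraint_val xbar y.

Definition h_sos (k : nat) : \bar R :=
  ereal_inf [set (peval h x)%:E
            | x in [set x | trunc_quad_module g k (constraint_poly x)]].

Definition d_S : nat := maxn 1 (\max_(j < s) half_deg (g j)).

Definition d_P : nat :=
  maxn d_S (maxn (\max_(i < m) half_deg (a i)) (half_deg b)).

End Problem.

(* Main.v *)
Require Import Defs.
From HB Require Import structures.
From mathcomp Require Import all_boot all_order all_algebra.
From mathcomp Require Import all_classical all_reals.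
From mathcomp Require Import ereal topology normedtype sequences convex.
From mathcomp Require Import -(notations) mpoly.
From mathcomp Require Import closed_field fraction generic_quotient ring_quotient.
From mathcomp Require Import polyorder polyrcf qe_rcf_th.
From mathcomp Require Import zify ring lra.

Import Order.TTheory GRing.Theory Num.Theory.
Import numFieldNormedType.Exports.

Local Open Scope classical_set_scope.
Local Open Scope ring_scope.

(** The statement reduces to Putinar's theorem: a polynomial that is positive on
    [S] lies in the quadratic module [Q(G)].  Indeed, moving a feasible point
    slightly towards the Slater point makes its constraint positive on [S], and
    convexity of [h] controls the change of the objective.

    As the Archimedean property is stated through a compact set [{psi >= 0}],
    one first has to find [k - |Y|^2] in the preordering [T] generated by [psi].
    If [|y|^2 < N] wherever [psi y >= 0], the Positivstellensatz gives
    [p (N - |Y|^2) = 1 + q] with [p], [q] in [T], and an argument of Woermann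
    turns this identity into the desired membership.  The Positivstellensatz
    follows from the Artin-Lang property: a maximal proper preordering of
    [R[Y]] is the nonnegative cone of an ordered ring, which maps to a real
    closed field, and finitely many sign conditions transfer from there back to
    the real numbers.  Only the subring generated by the coefficients and the
    variables matters, so the ring may be taken countable, and the real closed
    field is found as a maximal ordered subfield of an algebraic closure.
    Sign conditions are transferred one variable at a time, by counting roots
    with Cauchy indices, which are computed by pseudo-divisions.

    Finally, Putinar's theorem for Archimedean modules is proved following
    Jacobi, with a maximal proper quadratic module giving a point of [R^n]. *)

Set Implicit Arguments.
Unset Strict Implicit.
Unset Printing Implicit Defensive.

(** * Zorn's lemma and chains of sets *)

Lemma Zorn_above (T : Type) (good : set (set T)) (C : set T) : good C ->
    (forall F : set (set T), F !=set0 -> F `<=` good -> total_on F subset ->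
       good (\bigcup_(X in F) X)) ->
  exists M, [/\ good M, C `<=` M & forall D, good D -> M `<=` D -> D `<=` M].
Proof.
move=> C_good chain_good.
(* Zorn is applied to the sets added to [C], so that the empty chain is bounded by [C] itself. *)
have [F FP Ftot|A [A_good A_max]] := @Zorn_bigcup T [set A | good (C `|` A)].
  have [->|/set0P[A0 FA0]] := eqVneq F set0; first by rewrite bigcup_set0 /= setU0.
  rewrite /= (_ : _ `|` _ = \bigcup_(X in [set C `|` X | X in F]) X).
    apply: chain_good => [|_ [X FX <-]|_ _ [X FX <-] [Y FY <-]].
    - by exists (C `|` A0), A0.
    - exact: FP.
    - by case: (Ftot X Y FX FY) => XY; [left|right]; apply: setUS.
  apply/seteqP; split=> x.
    by move=> [Cx|[X FX Xx]]; [exists (C `|` A0)|exists (C `|` X)];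
       do ?[by left|by right|by exists A0|by exists X].
  by move=> [_ [X FX <-]] [Cx|Xx]; [left|right; exists X].
exists (C `|` A); split=> [//|x|D D_good AD x Dx]; first by left.
right; apply: contrapT => nAx; apply: (A_max D) => /=.
  by split; [move=> y Ay; apply: AD; right|move=> /(_ x Dx)].
by rewrite setUidr // => y Cy; apply: AD; left.
Qed.

Lemma chain_bigcup2 (T : Type) (F : set (set T)) x y : total_on F subset ->
    (\bigcup_(X in F) X) x -> (\bigcup_(X in F) X) y ->
  exists X, [/\ F X, X x & X y].
Proof.
move=> Ftot [X FX Xx] [Y FY Yy].
by have [XY|YX] := Ftot X Y FX FY; [exists Y|exists X]; split=> //; auto.
Qed.

(** ** Cauchy indices under specialization of the coefficients *)

Lemma cindexR_scale (F : rcfType) (c : F) (p q : {poly F}) :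
  cindexR (c *: p) q = sgz c * cindexR p q.
Proof.
by rewrite /cindexR mulr_sumr; apply: eq_bigr => x _; rewrite jump_mulCp.
Qed.

(** A Euclidean step: [r] is [c] times [p %% q], while [next_mod p q] is [p %% q] times minus a
    nonzero square, and only the signs of these factors affect the index. *)
Lemma cindexR_pseudo_division (F : rcfType) (c : F) (p q d r : {poly F}) :
    0 < c -> c *: p = d * q + r -> (size r < size q)%N ->
  cindexR q p = crossR (p * q) - cindexR r q.
Proof.
move=> c_gt0 def_p lt_rq.
have q_neq0 : q != 0 by rewrite -size_poly_gt0; apply: leq_ltn_trans lt_rq.
rewrite cindexR_rec; congr (_ + _).
have -> : r = c *: (p %% q) by rewrite -modpZl def_p modp_addl_mul_small.
have -> : next_mod p q = - (lead_coef q ^+ Pdiv.Ring.rscalp p q) ^+ 2 *: (p %% q).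
  rewrite /next_mod modpE scalerA expr2 !mulNr -mulrA divff ?mulr1 //.
  by rewrite expf_neq0 ?lead_coef_eq0.
rewrite !cindexR_scale sgzN (gtr0_sgz c_gt0) mul1r mulNr gtr0_sgz ?mul1r //.
by rewrite exprn_even_gt0 ?expf_neq0 ?lead_coef_eq0.
Qed.

Lemma crossRE (F : rcfType) (p : {poly F}) :
  crossR p = sgz (lead_coef p) *
    ((-1) ^+ (size p).-1 * sgz (lead_coef p) * sgz (lead_coef p) < 0 :> int).
Proof.
rewrite /crossR /variation /sgp_pinfty /sgp_minfty sgz_sgr; congr (_ * _).
rewrite -[in LHS]sgz_lt0 -sgz_lt0 !(sgzM, sgz_sgr, sgz_id).
by rewrite !sgzX !sgzN !sgz1.
Qed.

Section Determined.
Variables (A : idomainType) (O1 : rcfType) (phi1 : {rmorphism A -> O1}).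

Definition agree (H : seq A) (O : rcfType) (phi : {rmorphism A -> O}) :=
  forall h, h \in H -> sgz (phi h) = sgz (phi1 h).

(** Elimination without formulas: [H] is meant to collect the elements whose signs steer the
    computation of [X] along the branch taken at [phi1]. *)
Definition determined (T : Type) (X : forall O : rcfType, {rmorphism A -> O} -> T) :=
  exists H : seq A, forall (O : rcfType) (phi : {rmorphism A -> O}),
    agree H phi -> X O phi = X O1 phi1.

Lemma agree_cat H1 H2 (O : rcfType) (phi : {rmorphism A -> O}) :
  agree (H1 ++ H2) phi -> agree H1 phi /\ agree H2 phi.
Proof.
by move=> ag; split=> h hH; apply: ag; rewrite mem_cat hH ?orbT.
Qed.

Lemma agree_refl H : agree H phi1. Proof. by []. Qed.

Lemma agree_eq0 h (O : rcfType) (phi : {rmorphism A -> O}) :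
  agree [:: h] phi -> (phi h == 0) = (phi1 h == 0).
Proof. by move=> ag; rewrite -sgz_eq0 ag ?mem_head // sgz_eq0. Qed.

Lemma determined_const (T : Type) (x : T) : determined (fun _ _ => x).
Proof. by exists [::]. Qed.

Lemma determined_map (T U V : Type) (f : T -> U -> V)
    (X : forall O : rcfType, {rmorphism A -> O} -> T)
    (Y : forall O : rcfType, {rmorphism A -> O} -> U) :
  determined X -> determined Y -> determined (fun O phi => f (X O phi) (Y O phi)).
Proof.
move=> [H1 h1] [H2 h2]; exists (H1 ++ H2) => O phi /agree_cat[a1 a2].
by rewrite h1 // h2.
Qed.

Lemma determined_eq (T : Type) (H : seq A)
    (X Y : forall O : rcfType, {rmorphism A -> O} -> T) :
  (forall (O : rcfType) (phi : {rmorphism A -> O}), agree H phi -> X O phi = Y O phi) ->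
  determined Y -> determined X.
Proof.
move=> XY [H' h]; exists (H ++ H') => O phi /agree_cat[a1 a2].
by rewrite !XY // h.
Qed.

(* Dropping the leading coefficients that [phi1] kills, one may assume that the
   degree of a polynomial is preserved by specialization. *)
Lemma specialization_truncate (p : {poly A}) :
  exists (H : seq A) (p' : {poly A}), (size p' <= size p)%N /\
    forall (O : rcfType) (phi : {rmorphism A -> O}), agree H phi ->
      [/\ map_poly phi p = map_poly phi p', size (map_poly phi p') = size p'
        & sgz (lead_coef (map_poly phi p')) = sgz (phi1 (lead_coef p'))].
Proof.
have [n] := ubnP (size p); elim: n p => // n IHn p le_pn.
have [p0|p_neq0] := eqVneq p 0.
  exists [::], 0; split=> [|O phi _]; first by rewrite size_poly0.
  by split; rewrite ?p0 rmorph0 ?size_poly0 ?lead_coef0 ?rmorph0 ?sgz0.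
have [l0|l_neq0] := eqVneq (phi1 (lead_coef p)) 0.
  pose q := p - lead_coef p *: 'X^((size p).-1).
  have lt_qp : (size q < size p)%N.
    rewrite [X in (_ < X)%N]polySpred // ltnS; apply/leq_sizeP => j.
    rewrite leq_eqVlt coefB coefZ coefXn => /orP[/eqP<-|lt_j].
      by rewrite eqxx mulr1 subrr.
    by rewrite gtn_eqF // mulr0 subr0 nth_default // polySpred.
  have [H [p' [le_p' hp']]] := IHn q (leq_trans lt_qp le_pn).
  exists ([:: lead_coef p] ++ H), p'; split.
    exact: leq_trans le_p' (ltnW lt_qp).
  move=> O phi /agree_cat[a1 /hp'[<- -> ->]]; split=> //.
  have /eqP pl0 : phi (lead_coef p) == 0 by rewrite agree_eq0 // l0.
  by rewrite /q rmorphB /= map_polyZ /= pl0 scale0r subr0.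
exists [:: lead_coef p], p; split=> // O phi ag.
have pl_neq0 : phi (lead_coef p) != 0 by rewrite agree_eq0.
split=> //; first by rewrite size_map_poly_id0.
by rewrite lead_coef_map_id0 ?rmorph0 // ag ?mem_head.
Qed.

Lemma determined_lead (p : {poly A}) :
  determined (fun O (phi : {rmorphism A -> O}) => sgz (lead_coef (map_poly phi p))).
Proof.
have [H [p' [_ hp']]] := specialization_truncate p; exists H => O phi ag.
by have [-> _ ->] := hp' _ _ ag; have [-> _ ->] := hp' _ _ (@agree_refl H).
Qed.

Lemma determined_size (p : {poly A}) :
  determined (fun O (phi : {rmorphism A -> O}) => size (map_poly phi p)).
Proof.
have [H [p' [_ hp']]] := specialization_truncate p; exists H => O phi ag.
by have [-> -> _] := hp' _ _ ag; have [-> -> _] := hp' _ _ (@agree_refl H).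
Qed.

Lemma determined_crossR (p : {poly A}) :
  determined (fun O (phi : {rmorphism A -> O}) => crossR (map_poly phi p)).
Proof.
pose f (z : int) (n : nat) := z * ((-1) ^+ n.-1 * z * z < 0 :> int) : int.
have := determined_map f (determined_lead p) (determined_size p).
apply: (@determined_eq _ [::]) => O phi _; exact: crossRE.
Qed.

(** Signed remainder sequence, by induction on the size of [q]: remainders of the truncated
    polynomials are formed over [A], so one computation serves all [phi]. *)
Lemma determined_cindexR (p q : {poly A}) :
  determined (fun O (phi : {rmorphism A -> O}) =>
                cindexR (map_poly phi q) (map_poly phi p)).
Proof.
have [n] := ubnP (size q); elim: n p q => // n IHn p q le_qn.
have [Hp [p' [_ hp]]] := specialization_truncate p.
have [Hq [q' [le_q' hq]]] := specialization_truncate q.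
have [q0|q_neq0] := eqVneq q' 0.
  apply: (determined_eq (Y := fun _ _ => 0)) (determined_const _).
  by move=> O phi /hq[-> _ _]; rewrite q0 rmorph0 cindexR0p.
pose c := lead_coef q'; pose k := Pdiv.Ring.rscalp p' q'.
pose r := c ^+ k *: Pdiv.Ring.rmodp p' q'.
pose d := c ^+ k *: Pdiv.Ring.rdivp p' q'.
(* The multiplier is squared so that its image is positive as soon as [phi c] is nonzero. *)
have def_r : (c ^+ k) ^+ 2 *: p' = d * q' + r.
  by rewrite expr2 -scalerA Pdiv.ComRing.rdivp_eq scalerDr scalerAl.
have lt_rq : (size r < size q')%N.
  rewrite size_scale ?Pdiv.Ring.ltn_rmodpN0 //.
  by rewrite expf_neq0 ?lead_coef_eq0.
have det_r := IHn q' r (leq_trans lt_rq (leq_trans le_q' le_qn)).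
have := determined_map (fun x y : int => x - y) (determined_crossR (p' * q')) det_r.
apply: (@determined_eq _ (Hp ++ Hq)) => O phi /agree_cat[/hp[-> _ _] /hq[-> sq _]].
have pc : phi c != 0.
  apply/negP => /eqP c0; have := sq; rewrite -[in size (map_poly _ _)](coefK q').
  move/eqP; rewrite eqn_leq => /andP[_]; apply/negP; rewrite -ltnNge.
  rewrite [X in (_ < X)%N]polySpred // ltnS; apply/leq_sizeP => j.
  rewrite coef_map /= coefK leq_eqVlt => /orP[/eqP<-//|lt_j].
  by rewrite nth_default ?rmorph0 // polySpred.
rewrite rmorphM /=.
apply: (@cindexR_pseudo_division _ (phi ((c ^+ k) ^+ 2)) _ _ (map_poly phi d)).
- by rewrite rmorphXn /= exprn_even_gt0 //= rmorphXn expf_neq0.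
- by rewrite -map_polyZ /= def_r rmorphD rmorphM.
- by rewrite sq; apply: leq_ltn_trans (size_poly _ _) _.
Qed.

End Determined.

(* [s + s ^ 2] is [2] if the sign [s] is positive and [0] otherwise, so the sum
   below is [2 ^ (size gs)] times the number of roots of [p] at which all the
   polynomials in [gs] are positive. *)
Definition positive_root_sum (O : rcfType) (p acc : {poly O}) (gs : seq {poly O}) : int :=
  \sum_(x <- rootsR p)
    sgz acc.[x] * \prod_(g <- gs) (sgz g.[x] + sgz g.[x] ^+ 2).

Lemma positive_root_sum_gt0P (O : rcfType) (p : {poly O}) (gs : seq {poly O}) :
  reflect (exists2 x, x \in rootsR p & forall g, g \in gs -> 0 < g.[x])
    (0 < positive_root_sum p 1 gs).
Proof.
have fE (g : {poly O}) x : sgz g.[x] + sgz g.[x] ^+ 2 = (0 < g.[x])%R%:R * 2.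
  by case: sgzP.
have f_ge0 x : 0 <= \prod_(g <- gs) (sgz g.[x] + sgz g.[x] ^+ 2).
  by apply: prodr_ge0 => g _; rewrite fE mulr_ge0.
have -> : positive_root_sum p 1 gs =
    \sum_(x <- rootsR p) \prod_(g <- gs) (sgz g.[x] + sgz g.[x] ^+ 2).
  by apply: eq_bigr => x _; rewrite hornerC sgz1 mul1r.
rewrite lt_def sumr_ge0 // andbT psumr_neq0 //.
apply: (iffP hasP) => [] [x xp gx]; exists x => //.
  move=> g gsg; move: gx; rewrite /= lt_def => /andP[+ _].
  rewrite prodf_seq_neq0 => /allP /(_ g gsg) /=.
  by rewrite fE mulf_eq0 orbF pnatr_eq0 eqb0 negbK.
rewrite /= big_seq; apply: prodr_gt0 => g gsg.
by rewrite fE gx ?gsg.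
Qed.

(** * Transfer of sign conditions in one variable *)

Section Transfer.
Variables (A : idomainType) (O1 : rcfType) (phi1 : {rmorphism A -> O1}).

(** Each factor [s + s ^ 2] splits the sum in two, with [g] or [g ^ 2] absorbed into [acc]; without
    factors the sum is a Tarski query, which is a Cauchy index. *)
Lemma determined_positive_root_sum (p acc : {poly A}) (gs : seq {poly A}) :
  determined phi1 (fun O (phi : {rmorphism A -> O}) =>
    positive_root_sum (map_poly phi p) (map_poly phi acc) (map (map_poly phi) gs)).
Proof.
elim: gs acc => [|g gs IHgs] acc.
  have := determined_cindexR phi1 p (p^`() * acc).
  apply: (determined_eq (H := [::])) => O phi _.
  rewrite rmorphM /= -deriv_map -changes_mods_cindex -/(taqR _ _) -taq_taqR.
  by apply: eq_bigr => x _; rewrite big_nil mulr1.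
have := determined_map (fun x y : int => x + y) (IHgs (acc * g)) (IHgs (acc * g ^+ 2)).
apply: (determined_eq (H := [::])) => O phi _.
rewrite /positive_root_sum -big_split /=; apply: eq_bigr => x _.
rewrite big_cons -mulrDl mulrA; congr (_ * _).
by rewrite (expr2 g) !rmorphM /= !hornerM !sgzM mulrDr expr2.
Qed.

Lemma determined_all_sgz_lead (f : nat -> int -> bool) (gs : seq {poly A}) :
  determined phi1 (fun O (phi : {rmorphism A -> O}) =>
    all (fun g : {poly O} => f (size g) (sgz (lead_coef g))) (map (map_poly phi) gs)).
Proof.
elim: gs => [|g gs IHgs]; first exact: determined_const.
have := determined_map f (determined_size phi1 g) (determined_lead phi1 g).
by move=> /(determined_map andb) /(_ IHgs).
Qed.

Let positive_at (O : rcfType) (gs : seq {poly O}) :=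
  exists x, forall g, g \in gs -> 0 < g.[x].

Lemma positive_atE (O : rcfType) (gs : seq {poly O}) :
  (exists x, \big[andb/true]_(g <- gs) (g.[x] > 0)) <-> positive_at gs.
Proof.
by split=> [] [x]; rewrite ?big_all => gx; exists x; last rewrite big_all;
   apply/allP.
Qed.

Lemma transfer_positive_root (p : {poly A}) (gs : seq {poly A}) :
  exists H : seq A, forall (O : rcfType) (phi : {rmorphism A -> O}), agree phi1 H phi ->
    (exists2 x, x \in rootsR (map_poly phi1 p)
       & forall g, g \in gs -> 0 < (map_poly phi1 g).[x]) ->
    (exists2 x, x \in rootsR (map_poly phi p)
       & forall g, g \in gs -> 0 < (map_poly phi g).[x]).
Proof.
have [H hH] := determined_positive_root_sum p 1 gs; exists H => O phi ag [x1 x1p x1g].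
have /positive_root_sum_gt0P[x xp xg] :
    0 < positive_root_sum (map_poly phi p) 1 (map (map_poly phi) gs).
  have := hH _ _ ag; rewrite !rmorph1 => ->.
  by apply/positive_root_sum_gt0P; exists x1 => // _ /mapP[g gsg ->]; apply: x1g.
by exists x => // g gsg; apply: xg; apply: map_f.
Qed.

(** A solvable system of strict inequalities is solvable near plus or minus infinity, as leading
    coefficients show ([f], [f']), or at a root of the derivative of the product, where root
    counting applies. *)
Lemma transfer_positive (gs : seq {poly A}) :
  exists H : seq A, forall (O : rcfType) (phi : {rmorphism A -> O}), agree phi1 H phi ->
    positive_at (map (map_poly phi1) gs) -> positive_at (map (map_poly phi) gs).
Proof.
(* The factor [X ^ 2 + 1] makes the bounding polynomial nonzero. *)
pose hs := 'X^2 + 1 :: gs.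
pose b := (\prod_(q <- hs) q)^`().
pose f (n : nat) (z : int) := 0 < z; pose f' (n : nat) (z : int) := 0 < (-1) ^+ n.-1 * z.
have [H1 h1] := determined_all_sgz_lead f hs.
have [H2 h2] := determined_all_sgz_lead f' hs.
have [H3 h3] := transfer_positive_root b hs.
exists (H1 ++ H2 ++ H3) => O phi /agree_cat[a1 /agree_cat[a2 a3]].
have ext (O' : rcfType) (psi : {rmorphism A -> O'}) :
    positive_at (map (map_poly psi) hs) <-> positive_at (map (map_poly psi) gs).
  split=> [] [x gx]; exists x => g gsg; first by apply: gx; rewrite inE gsg orbT.
  move: gsg; rewrite inE => /orP[/eqP->|]; last exact: gx.
  rewrite rmorphD /= map_polyXn rmorph1 hornerD hornerXn hornerC.
  by rewrite ltr_wpDl ?sqr_ge0.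
move=> /ext/positive_atE/bounding_polyP alt; apply/ext/positive_atE/bounding_polyP.
have E1 (O' : rcfType) (psi : {rmorphism A -> O'}) :
    \big[andb/true]_(q <- map (map_poly psi) hs) (0 < lead_coef q) =
    all (fun g : {poly O'} => f (size g) (sgz (lead_coef g))) (map (map_poly psi) hs).
  by rewrite big_all; apply: eq_all => g; rewrite /f sgz_gt0.
have E2 (O' : rcfType) (psi : {rmorphism A -> O'}) :
    \big[andb/true]_(q <- map (map_poly psi) hs) (0 < (-1) ^+ (size q).-1 * lead_coef q) =
    all (fun g : {poly O'} => f' (size g) (sgz (lead_coef g))) (map (map_poly psi) hs).
  rewrite big_all; apply: eq_all => g.
  by rewrite /f' -sgz_gt0 sgzM sgzX sgzN sgz1.
have E3 (O' : rcfType) (psi : {rmorphism A -> O'}) :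
    bounding_poly (map (map_poly psi) hs) = map_poly psi b.
  by rewrite /bounding_poly big_map /b -deriv_map rmorph_prod.
case: alt; rewrite ?E1 ?E2.
- by move=> alt; constructor 1; rewrite h1.
- by move=> alt; constructor 2; rewrite h2.
move=> [x]; rewrite E3 big_all => /andP[bx /allP gx]; constructor 3.
(* [rootsR] lists nothing for the zero polynomial, so the derivative has to be nonzero for [x] to be
   listed. *)
have b_neq0 : map_poly phi1 b != 0.
  rewrite -E3 /bounding_poly -derivn1 -derivn_poly0 -ltnNge big_cons.
  set r := \prod_(_ <- _) _; have r_neq0 : r != 0.
    rewrite prodf_seq_neq0; apply/allP => g gsg; apply/implyP => _.
    apply/eqP => g0; have := gx g; rewrite inE gsg orbT g0 horner0 ltxx.
    by move=> /(_ isT).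
  have s3 : size (map_poly phi1 ('X^2 + 1)) = 3%N.
    by rewrite rmorphD /= map_polyXn rmorph1 size_polyDl ?size_polyXn ?size_poly1.
  have q_neq0 : map_poly phi1 ('X^2 + 1) != 0 by rewrite -size_poly_gt0 s3.
  by rewrite size_mul // s3 [size r]polySpred.
have [| y yb yg] := h3 _ _ a3.
  exists x; last by move=> g hg; apply: gx; apply: map_f.
  by rewrite -roots_on_rootsR // in_itv /= rootE.
exists y; rewrite E3 big_all; apply/andP; split; last first.
  by apply/allP => _ /mapP[g hg ->]; apply: yg.
have [b0|pb_neq0] := eqVneq (map_poly phi b) 0.
  by move: yb; rewrite b0 rootsR0.
by move: yb; rewrite -roots_on_rootsR // => /andP[_].
Qed.

(** The elements of [F] vanishing at [x1] are merged into one sum of squares [p], the others become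
    strict inequalities. Either [p] is zero and only the inequalities count, or [x1] is among its
    finitely many roots. *)
Lemma transfer_sgz (F : seq {poly A}) (x1 : O1) :
  exists H : seq A, forall (O : rcfType) (phi : {rmorphism A -> O}), agree phi1 H phi ->
  exists x : O, forall f, f \in F ->
    sgz (map_poly phi f).[x] = sgz (map_poly phi1 f).[x1].
Proof.
pose val1 f := (map_poly phi1 f).[x1].
pose gs := [seq f <- F | 0 < val1 f] ++ [seq - f | f <- F & val1 f < 0].
pose zs := [seq f <- F | val1 f == 0].
pose p := \sum_(z <- zs) z ^+ 2.
have gs1 g : g \in gs -> 0 < val1 g.
  rewrite mem_cat mem_filter => /orP[/andP[]//|/mapP[f]].
  by rewrite mem_filter => /andP[f_lt0 _] ->; rewrite /val1 rmorphN hornerN oppr_gt0.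
have sgzF (O : rcfType) (phi : {rmorphism A -> O}) x :
    (forall g, g \in gs -> 0 < (map_poly phi g).[x]) ->
    (forall z, z \in zs -> (map_poly phi z).[x] = 0) ->
    forall f, f \in F -> sgz (map_poly phi f).[x] = sgz (val1 f).
  move=> xg xz f Ff; case: (ltgtP (val1 f) 0) => f1.
  - rewrite (ltr0_sgz f1) ltr0_sgz // -oppr_gt0 -hornerN -rmorphN xg //.
    by rewrite mem_cat map_f ?orbT // mem_filter f1.
  - by rewrite (gtr0_sgz f1) gtr0_sgz // xg // mem_cat mem_filter f1 Ff.
  - by rewrite f1 xz ?sgz0 // mem_filter Ff andbT; apply/eqP.
have pE (O : rcfType) (phi : {rmorphism A -> O}) x :
    (map_poly phi p).[x] = \sum_(z <- zs) (map_poly phi z).[x] ^+ 2.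
  by rewrite rmorph_sum horner_sum; apply: eq_bigr => z _; rewrite rmorphXn horner_exp.
have p_root (O : rcfType) (phi : {rmorphism A -> O}) x :
    (map_poly phi p).[x] = 0 <-> forall z, z \in zs -> (map_poly phi z).[x] = 0.
  rewrite pE; split=> [/eqP|xz]; last by rewrite big_seq big1 // => z /xz->; rewrite expr0n.
  rewrite psumr_eq0 => [/allP xz z /xz|z _]; last exact: sqr_ge0.
  by rewrite /= sqrf_eq0 => /eqP.
have [p0|p_neq0] := eqVneq (map_poly phi1 p) 0.
  have z1 z : z \in zs -> map_poly phi1 z = 0.
    move=> zz; apply/eqP; apply/negPn/negP => z_neq0.
    (* The Cauchy bound is not a root of a nonzero polynomial, whereas [z] vanishes everywhere as
       [p] does. *)
    have /negP[] : ~~ root (map_poly phi1 z) (cauchy_bound (map_poly phi1 z)).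
      by rewrite ge_cauchy_bound // in_itv /= lexx.
    rewrite rootE; apply/eqP;
    by apply: (iffLR (p_root _ phi1 _)) zz; rewrite p0 horner0.
  have [H1 h1] := determined_all_sgz_lead (fun n _ => n == 0%N) zs.
  have [H2 h2] := transfer_positive gs.
  exists (H1 ++ H2) => O phi /agree_cat[/h1 + /h2 +].
  have -> : all (fun g : {poly O1} => size g == 0%N) (map (map_poly phi1) zs).
    by apply/allP => _ /mapP[z /z1 z0 ->]; rewrite z0 size_poly0.
  move=> /allP z2 [|x xg].
    by exists x1 => _ /mapP[g /gs1 ? ->].
  exists x; apply: sgzF => [g gsg|z zz]; first by apply: xg; apply: map_f.
  have /z2 : map_poly phi z \in map (map_poly phi) zs by apply: map_f.
  by rewrite size_poly_eq0 => /eqP->; rewrite horner0.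
have [H h] := transfer_positive_root p gs; exists H => O phi /h[|x xp xg].
  exists x1; last exact: gs1.
  rewrite -roots_on_rootsR // in_itv /= rootE; apply/eqP/p_root => z.
  by rewrite mem_filter => /andP[/eqP].
exists x; apply: sgzF => //; apply/p_root/eqP; rewrite -rootE.
have [b0|pb_neq0] := eqVneq (map_poly phi p) 0; first by rewrite b0 root0.
by move: xp; rewrite -roots_on_rootsR // => /andP[_].
Qed.

End Transfer.

(** ** Real closed fields from ordered rings *)

Lemma poly_neq0_nonroot (F : numDomainType) (q : {poly F}) :
  q != 0 -> exists t : F, q.[t] != 0.
Proof.
move=> q0; apply: contrapT => /forallNP qt.
have /(max_poly_roots q0) : all (root q) [seq i%:R | i <- iota 0 (size q)].
  by apply/allP => t _; apply/negPn/negP/qt.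
rewrite map_inj_uniq ?iota_uniq => [/(_ isT)|i j /eqP]; last by rewrite eqr_nat => /eqP.
by rewrite size_map size_iota ltnn.
Qed.

(** * Sums of squares with positive weights *)

Section WeightedSums.
Variable F : realFieldType.

(** The weights stay outside the squares because a positive element of [F] need not be a square. *)
Definition weighted_sum (s : seq (F * {poly F})) : {poly F} :=
  \sum_(cq <- s) cq.1 *: cq.2 ^+ 2.

Lemma weighted_sum_cat s1 s2 :
  weighted_sum (s1 ++ s2) = weighted_sum s1 + weighted_sum s2.
Proof. by rewrite /weighted_sum big_cat. Qed.

Lemma weighted_sumM s1 s2 : weighted_sum s1 * weighted_sum s2 =
  weighted_sum [seq (c1.1 * c2.1, c1.2 * c2.2) | c1 <- s1, c2 <- s2].
Proof.
rewrite /weighted_sum big_allpairs_dep mulr_suml; apply: eq_bigr => c1 _.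
rewrite mulr_sumr; apply: eq_bigr => c2 _ /=.
by rewrite exprMn -scalerAl -scalerAr scalerA.
Qed.

Lemma horner_weighted_sum s t :
  (weighted_sum s).[t] = \sum_(cq <- s) cq.1 * cq.2.[t] ^+ 2.
Proof.
by rewrite horner_sum; apply: eq_bigr => cq _; rewrite hornerZ horner_exp.
Qed.

(* A sum of squares with positive weights cannot be divisible by a polynomial
   [p] of larger degree than the summands if [p] is of minimal degree among the
   polynomials changing sign without having a root: the cofactor would
   change sign too, and its roots can be divided out. *)
Lemma weighted_sum_indivisible (p : {poly F}) (a b : F) :
    p.[a] < 0 < p.[b] -> (forall x, ~~ root p x) ->
    (forall q : {poly F}, (size q < size p)%N -> q.[a] <= 0 <= q.[b] ->
       exists x, root q x) ->
  forall s : seq (F * {poly F}), (forall cq, cq \in s -> 0 < cq.1 /\ (size cq.2 < size p)%N) ->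
    p %| weighted_sum s -> forall cq, cq \in s -> cq.2 = 0.
Proof.
move=> /andP[pa pb] p_noroot p_min s.
have [n] := ubnP (size (weighted_sum s)); elim: n s => // n IHn s le_sn hs p_dvd.
have root_all r : root (weighted_sum s) r -> forall cq, cq \in s -> root cq.2 r.
  rewrite rootE horner_weighted_sum big_seq psumr_eq0 => [/allP h cq scq|cq scq].
    have := h cq scq; rewrite scq mulf_eq0 sqrf_eq0 gt_eqF //.
    by have [] := hs cq scq.
  by rewrite mulr_ge0 ?sqr_ge0 // ltW //; have [] := hs cq scq.
have [s0|s_neq0] := eqVneq (weighted_sum s) 0.
  move=> cq scq; apply/eqP/negPn/negP => /poly_neq0_nonroot[t].
  by rewrite -rootE root_all // s0 root0.
have /dvdpP[h def_s] := p_dvd.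
have h_neq0 : h != 0 by apply: contraNneq s_neq0 => h0; rewrite def_s h0 mul0r.
have p_neq0 : p != 0 by apply: contraNneq s_neq0 => p0; rewrite def_s p0 mulr0.
have lt_hp : (size h < size p)%N.
  (* The squares have size at most [2 * size p - 3], which leaves the cofactor [h] smaller than
     [p]. *)
  have : (size (weighted_sum s) <= size p + size p - 3)%N.
    rewrite /weighted_sum; apply: (leq_trans (size_sum _ _ _)).
    rewrite big_seq; elim/big_ind: _ => [//|x y|cq scq]; first by rewrite geq_max => -> ->.
    have [_] := hs _ scq; case: cq {scq} => c q /= lt_q.
    apply: leq_trans (size_scale_leq _ _) _; rewrite expr2.
    apply: leq_trans (size_polyMleq _ _) _.
    by move: (size q) (size p) lt_q => m k; lia.
  have : (0 < size p)%N by rewrite size_poly_gt0.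
  by rewrite def_s size_mul //; move: (size h) (size p) => i k; lia.
have ws_ge0 t : 0 <= (weighted_sum s).[t].
  rewrite horner_weighted_sum big_seq; apply: sumr_ge0 => cq scq.
  by rewrite mulr_ge0 ?sqr_ge0 // ltW //; have [] := hs cq scq.
have [r hr] : exists r, root h r.
  apply: p_min => //; have := ws_ge0 a; have := ws_ge0 b; rewrite def_s !hornerM.
  by rewrite pmulr_lge0 // nmulr_lge0 // => -> ->.
have sr : root (weighted_sum s) r by rewrite def_s rootM hr.
(* By positivity every summand vanishes at [r]. Dividing each of them by ['X - r%:P] keeps [p] as a
   divisor of the sum, since [r] is not a root of [p]. *)
pose s' := [seq (cq.1, cq.2 %/ ('X - r%:P)) | cq <- s].
have qE cq : cq \in s -> cq.2 = (cq.2 %/ ('X - r%:P)) * ('X - r%:P).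
  by move=> /(root_all r sr); rewrite root_factor_theorem dvdp_eq => /eqP.
have def_s' : weighted_sum s = weighted_sum s' * ('X - r%:P) ^+ 2.
  rewrite /weighted_sum big_map mulr_suml big_seq [RHS]big_seq.
  by apply: eq_bigr => cq /qE {1}->; rewrite exprMn scalerAl.
have s'_neq0 : weighted_sum s' != 0.
  by apply: contraNneq s_neq0 => s0; rewrite def_s' s0 mul0r.
move=> cq scq; suff q0 : cq.2 %/ ('X - r%:P) = 0 by rewrite (qE cq scq) q0 mul0r.
apply: (IHn s' _ _ _ (cq.1, cq.2 %/ ('X - r%:P))).
- rewrite ltnS in le_sn; apply: leq_trans le_sn; rewrite def_s' size_mul ?expf_neq0 ?polyXsubC_eq0 //.
  by rewrite size_exp_XsubC addn3.
- move=> _ /mapP[dq sdq ->] /=; have [? lt_q] := hs dq sdq; split=> //.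
  by apply: leq_ltn_trans lt_q; rewrite size_divp ?polyXsubC_eq0 // leq_subr.
- have : coprimep p (('X - r%:P) ^+ 2).
    by rewrite coprimep_expr // coprimep_XsubC p_noroot.
  by move=> /Gauss_dvdpl <-; rewrite -def_s'.
- by apply/mapP; exists cq.
Qed.

End WeightedSums.

(* An ordered subring of a field, given by its cone [C] of nonnegative elements;
   the underlying subring is [C - C]. *)
Record ordering_cone (K : fieldType) (C : set K) : Prop := OrderingCone {
  coneD : forall x y, C x -> C y -> C (x + y);
  coneM : forall x y, C x -> C y -> C (x * y);
  cone_sqrB : forall x y, C x -> C y -> C ((x - y) ^+ 2);
  cone1 : C 1;
  cone_anti : forall x, C x -> C (- x) -> x = 0 }.

(** * Maximal ordering cones in an algebraically closed field *)

Section MaximalCone.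
Variables (K : fieldType) (C : set K).
Hypothesis K_closed : forall p : {poly K}, size p != 1%N -> exists x, root p x.
Hypothesis C_cone : ordering_cone C.
Hypothesis C_max : forall D, ordering_cone D -> C `<=` D -> D `<=` C.

Let E (x : K) := exists2 y, C y & C (y - x).

Let CD := coneD C_cone.
Let CM := coneM C_cone.
Let C_anti := cone_anti C_cone.

Let C0 : C 0.
Proof. by have := cone_sqrB C_cone (cone1 C_cone) (cone1 C_cone); rewrite subrr expr0n. Qed.

Let C_sqr x : E x -> C (x ^+ 2).
Proof.
by move=> [y Cy Cyx]; have := cone_sqrB C_cone Cy Cyx; rewrite opprB addrC subrK.
Qed.

Let CE x : C x -> E x.
Proof. by move=> Cx; exists x => //; rewrite subrr. Qed.

Let EB x y : E x -> E y -> E (x - y).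
Proof.
move=> [a Ca Cax] [b Cb Cby]; exists (a + (b - y)); first exact: CD.
by rewrite (_ : _ - _ = (a - x) + b); [exact: CD|ring].
Qed.

Let EM x y : E x -> E y -> E (x * y).
Proof.
move=> [a Ca Cax] [b Cb Cby]; exists (a * b + (a - x) * (b - y)).
  by apply: CD; apply: CM.
rewrite (_ : _ - _ = (a - x) * b + a * (b - y)); last by ring.
by apply: CD; apply: CM.
Qed.

(** Fractions [c / y ^ 2] with [c] in [C] and [y] in [C - C] form a cone containing [C], so
    maximality puts them in [C]. *)
Let CV x : E x -> x != 0 -> C (x ^- 2).
Proof.
move=> Ex x_neq0.
pose D : set K := [set z | exists c y, [/\ C c, E y, y != 0 & z = c / y ^+ 2]].
have DP c y : C c -> E y -> y != 0 -> D (c / y ^+ 2) by move=> *; exists c, y.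
have D_cone : ordering_cone D.
  split.
  - move=> _ _ [c [y [Cc Ey y0 ->]]] [d [z [Cd Ez z0 ->]]].
    rewrite (_ : _ + _ = (c * z ^+ 2 + d * y ^+ 2) / (y * z) ^+ 2); last first.
      by field; rewrite y0 z0.
    apply: DP; [|exact: EM|by rewrite mulf_neq0].
    by apply: CD; apply: CM => //; apply: C_sqr.
  - move=> _ _ [c [y [Cc Ey y0 ->]]] [d [z [Cd Ez z0 ->]]].
    rewrite (_ : _ * _ = c * d / (y * z) ^+ 2); last by field; rewrite y0 z0.
    by apply: DP; [exact: CM|exact: EM|rewrite mulf_neq0].
  - move=> _ _ [c [y [Cc Ey y0 ->]]] [d [z [Cd Ez z0 ->]]].
    rewrite (_ : (_ - _) ^+ 2 =
      (c * z ^+ 2 - d * y ^+ 2) ^+ 2 / ((y * z) ^+ 2) ^+ 2); last first.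
      by field; rewrite y0 z0.
    apply: DP; last by rewrite expf_neq0 // mulf_neq0.
      by apply: C_sqr; apply: EB; apply: CE; apply: CM => //; apply: C_sqr.
    by apply: CE; apply: C_sqr; apply: EM.
  - by exists 1, 1; split; rewrite ?expr1n ?divr1 ?oner_eq0 //;
      try apply: CE; apply: cone1.
  - move=> _ [c [y [Cc Ey y0 ->]]] [d [z [Cd Ez z0 e]]].
    have {}e : c * z ^+ 2 = - (d * y ^+ 2).
      have := congr1 (fun t => - t * (y * z) ^+ 2) e.
      rewrite /= opprK => e'; rewrite -[LHS](_ : c / y ^+ 2 * (y * z) ^+ 2 = _).
        by rewrite e'; field.
      by field.
    have : c * z ^+ 2 = 0.
      apply: C_anti; first by apply: CM => //; apply: C_sqr.
      by rewrite e opprK; apply: CM => //; apply: C_sqr.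
    by move/eqP; rewrite mulf_eq0 sqrf_eq0 (negPf z0) orbF => /eqP->; rewrite mul0r.
apply: (C_max D_cone).
  by move=> c Cc; exists c, 1; split; rewrite ?expr1n ?divr1 ?oner_eq0 //;
    apply: CE; apply: cone1.
by rewrite -[_ ^- 2]mul1r; apply: DP => //; apply: cone1.
Qed.

Let EV x : E x -> E x^-1.
Proof.
move=> Ex; have [->|x0] := eqVneq x 0; first by rewrite invr0; apply: CE.
rewrite (_ : x^-1 = x * x ^- 2); last by field.
by apply: EM => //; apply: CE; apply: CV.
Qed.

(** If [x] is not in [C], adjoining [- x] still gives a cone: a failure of antisymmetry reads
    [a + a' = x * (b + b')] with [b + b'] nonzero, and makes [x] an element of [C] times an inverse
    square. *)
Let C_total x : E x -> C x \/ C (- x).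
Proof.
move=> Ex; have [Cx|nCx] := pselect (C x); first by left.
right; pose D : set K := [set z | exists a b, [/\ C a, C b & z = a - x * b]].
have DP a b : C a -> C b -> D (a - x * b) by move=> *; exists a, b.
have CDsub c : C c -> D c by move=> Cc; exists c, 0; split; rewrite ?mulr0 ?subr0.
have D_cone : ordering_cone D.
  have DE z : D z -> E z.
    by move=> [a [b [Ca Cb ->]]]; apply: EB (CE Ca) (EM Ex (CE Cb)).
  split.
  - move=> _ _ [a [b [Ca Cb ->]]] [a' [b' [Ca' Cb' ->]]].
    by rewrite (_ : _ + _ = a + a' - x * (b + b')); [apply: DP; apply: CD|ring].
  - move=> _ _ [a [b [Ca Cb ->]]] [a' [b' [Ca' Cb' ->]]].
    rewrite (_ : _ * _ = a * a' + x ^+ 2 * (b * b') - x * (a * b' + a' * b));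
      last by ring.
    by apply: DP; apply: CD; apply: CM => //; first [exact: C_sqr | exact: CM].
  - by move=> y z Dy Dz; apply/CDsub/C_sqr/EB; apply: DE.
  - by apply: CDsub; apply: cone1.
  move=> _ [a [b [Ca Cb ->]]] [a' [b' [Ca' Cb' e]]].
  have {}e : a + a' = x * (b + b').
    by apply/eqP; rewrite -subr_eq0; apply/eqP; move: e => /eqP;
       rewrite -subr_eq0 => /eqP e; rewrite -[RHS]oppr0 -e; ring.
  have [b0|b_neq0] := eqVneq (b + b') 0.
    have b00 : b = 0.
      by apply: C_anti => //; rewrite -(_ : b' = - b) // -[b'](addKr b) b0 addr0.
    have a00 : a = 0.
      apply: C_anti => //; move: e; rewrite b0 mulr0 => a0.
      by rewrite -(_ : a' = - a) // -[a'](addKr a) a0 addr0.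
    by rewrite a00 b00 mulr0 subrr.
  case: nCx; rewrite (_ : x = (a + a') * (b + b') * (b + b') ^- 2); last first.
    by rewrite e; field.
  apply: CM; first by apply: CM; apply: CD.
  by apply: CV => //; apply/CE/CD.
apply: (C_max D_cone) => //.
by exists 0, 1; split=> //; [apply: cone1|rewrite mulr1 sub0r].
Qed.

(** * The real closed field of a maximal cone *)

Definition real_carrier_pred : {pred K} := fun x => `[< E x >].

Let E_divring : divring_closed real_carrier_pred.
Proof.
split=> [|x y /asboolP Ex /asboolP Ey|x y /asboolP Ex /asboolP Ey]; apply/asboolP.
- exact: CE (cone1 C_cone).
- exact: EB.
- by apply: EM => //; apply: EV.
Qed.

HB.instance Definition _ := GRing.isDivringClosed.Build K real_carrier_pred E_divring.

Record real_carrier := RealCarrier {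
  real_carrier_val :> K; _ : real_carrier_val \in real_carrier_pred }.

HB.instance Definition _ := [isSub for real_carrier_val].
HB.instance Definition _ := [Choice of real_carrier by <:].
HB.instance Definition _ := [SubChoice_isSubIntegralDomain of real_carrier by <:].
HB.instance Definition _ := [SubIntegralDomain_isSubField of real_carrier by <:].

Implicit Types x y : real_carrier.

Let le x y := `[< C (val y - val x) >].
Let norm x := if le 0 x then x else - x.

Let leE x : le 0 x = `[< C (val x) >].
Proof. by rewrite /le rmorph0 subr0. Qed.

Let le_sub x y : le 0 (y - x) = le x y.
Proof. by rewrite leE rmorphB. Qed.

Let le0_add x y : le 0 x -> le 0 y -> le 0 (x + y).
Proof.
by rewrite !leE => /asboolP Cx /asboolP Cy; apply/asboolP; rewrite rmorphD; apply: CD.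
Qed.

Let le0_mul x y : le 0 x -> le 0 y -> le 0 (x * y).
Proof.
by rewrite !leE => /asboolP Cx /asboolP Cy; apply/asboolP; rewrite rmorphM; apply: CM.
Qed.

Let le0_anti x : le 0 x -> le x 0 -> x = 0.
Proof.
rewrite leE -le_sub sub0r leE => /asboolP Cx /asboolP; rewrite rmorphN => CNx.
by apply: val_inj; rewrite rmorph0; apply: C_anti.
Qed.

Let le0_total x : le 0 x || le x 0.
Proof.
rewrite -(le_sub x) sub0r !leE; have /asboolP/C_total[Cx|CNx] := valP x.
  by apply/orP; left; apply/asboolP.
by apply/orP; right; apply/asboolP; rewrite rmorphN.
Qed.

Let normN x : norm (- x) = norm x.
Proof.
rewrite /norm; have [x0|x0] := boolP (le 0 x); have [y0|y0] := boolP (le 0 (- x)).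
- by rewrite (le0_anti x0) ?oppr0 // -le_sub sub0r.
- by rewrite opprK.
- by [].
- by have := le0_total x; rewrite (negPf x0) -(le_sub x) sub0r (negPf y0).
Qed.

Let ge0_norm x : le 0 x -> norm x = x.
Proof. by rewrite /norm => ->. Qed.

HB.instance Definition _ := Num.IntegralDomain_isLeReal.Build real_carrier
  le0_add le0_mul le0_anti le_sub le0_total normN ge0_norm (fun _ _ => erefl).

Lemma real_carrier_ge0 x : (0 <= x) <-> C (val x).
Proof. by rewrite -[0 <= x]/(le 0 x) leE; split=> /asboolP. Qed.

Lemma real_carrier_surj (c : K) : C c -> exists2 x : real_carrier, 0 <= x & val x = c.
Proof.
move=> Cc; have Ec : c \in real_carrier_pred by apply/asboolP/CE.
by exists (Sub c Ec : real_carrier); rewrite ?SubK //; apply/real_carrier_ge0; rewrite SubK.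
Qed.

Local Notation O := real_carrier.

Let lift_root (p : {poly O}) : (forall x : O, ~~ root p x) ->
  forall z, root (map_poly val p) z -> ~ E z.
Proof.
move=> p_noroot z pz Ez; have zE : z \in real_carrier_pred by apply/asboolP.
have := p_noroot (Sub z zE); rewrite -(fmorph_root (val : {rmorphism O -> K})).
by rewrite /= pz.
Qed.

Let E_half z : C ((2^-1 * (z + 1)) ^+ 2) -> C ((2^-1 * (z - 1)) ^+ 2) -> E z.
Proof.
have two_neq0 : (2 : K) != 0.
  have -> : (2 : K) = val (2 : O) by rewrite rmorph_nat.
  by rewrite fmorph_eq0 pnatr_eq0.
move=> Cp Cm; exists ((2^-1 * (z + 1)) ^+ 2) => //.
by rewrite (_ : _ - z = (2^-1 * (z - 1)) ^+ 2) //; field.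
Qed.

(* Otherwise, for [p] of minimal degree and [z] a root of [p] in [K], the
   ordering extends to the field generated by [z], against maximality. *)
Lemma real_carrier_root (p : {poly O}) (a b : O) :
  p.[a] * p.[b] < 0 -> exists x, root p x.
Proof.
have [n] := ubnP (size p); elim: n p a b => // n IHn p a b le_pn pab.
apply: contrapT => /forallNP p_noroot'.
have p_noroot x : ~~ root p x by apply/negP/p_noroot'.
have p_min (q : {poly O}) : (size q < size p)%N -> q.[a] * q.[b] <= 0 -> exists x, root q x.
  move=> lt_qp; rewrite le_eqVlt mulf_eq0 => /orP[/orP[]qx|].
  - by exists a.
  - by exists b.
  - by apply: IHn; apply: leq_trans lt_qp _.
have p_neq0 : p != 0 by apply: contraTneq pab => ->; rewrite !horner0 mulr0 ltxx.
(* In a proper factorization of [p], one factor changes sign between [a] and [b] or vanishes at one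
   of them, so minimality gives it a root. *)
have p_irr (q : {poly O}) : ~~ coprimep p q -> p %| q.
  rewrite /coprimep => g_neq1; set g := gcdp p q in g_neq1.
  have /dvdpP[h def_p] : g %| p by apply: dvdp_gcdl.
  have /andP[h_neq0 g_neq0] : (h != 0) && (g != 0).
    by move: p_neq0; rewrite def_p mulf_eq0 negb_or.
  have sp : size p = (size h + size g).-1 by rewrite def_p size_mul.
  have h_gt0 : (0 < size h)%N by rewrite size_poly_gt0.
  have g_gt0 : (0 < size g)%N by rewrite size_poly_gt0.
  have [h1|h_neq1] := eqVneq (size h) 1%N.
    have : g %= p by rewrite -dvdp_size_eqp ?dvdp_gcdl // sp h1.
    by rewrite eqp_sym => /andP[/dvdp_trans + _]; apply; apply: dvdp_gcdr.
  have lt_gp : (size g < size p)%N.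
    by rewrite sp; move: (size g) (size h) h_gt0 h_neq1 => i j; lia.
  have lt_hp : (size h < size p)%N.
    by rewrite sp; move: (size g) (size h) g_gt0 g_neq1 => i j; lia.
  have [ga|ga] := lerP (g.[a] * g.[b]) 0.
    by have [x gx] := p_min g lt_gp ga; have := p_noroot x; rewrite def_p rootM gx orbT.
  have ha : h.[a] * h.[b] <= 0.
    move: pab; rewrite def_p !hornerM mulrACA => /ltW.
    by rewrite pmulr_lle0.
  by have [x hx] := p_min h lt_hp ha; have := p_noroot x; rewrite def_p rootM hx.
pose val' : {rmorphism O -> K} := val.
have [z pz] : exists z, root (map_poly val p) z.
  apply: K_closed; rewrite size_map_poly; apply: contraL pab => /eqP p1.
  by rewrite [p]size1_polyC ?p1 // !hornerC -leNgt -expr2 sqr_ge0.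
pose ez q := (map_poly (val : O -> K) q).[z].
have ezD q r : ez (q + r) = ez q + ez r by rewrite /ez rmorphD hornerD.
have ezN q : ez (- q) = - ez q by rewrite /ez rmorphN hornerN.
have ezM q r : ez (q * r) = ez q * ez r by rewrite /ez rmorphM hornerM.
have ezC c : ez c%:P = val c by rewrite /ez map_polyC hornerC.
have ezZ c q : ez (c *: q ^+ 2) = val c * ez q ^+ 2.
  by rewrite -mul_polyC expr2 !ezM ezC expr2.
have ez_mod q : ez (q %% p) = ez q.
  by rewrite [in RHS](divp_eq q p) ezD ezM [ez p](rootP pz) mulr0 add0r.
have ezX : ez 'X = z by rewrite /ez map_polyX hornerX.
(* This will give the antisymmetry of [D]: a weighted sum vanishing at [z] is, after reduction of
   its summands modulo [p], divisible by [p], so the reduced summands are zero. *)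
have vanish s : (forall cq, cq \in s -> 0 <= cq.1) -> ez (weighted_sum s) = 0 ->
    forall cq, cq \in s -> ez (cq.1 *: cq.2 ^+ 2) = 0.
  move=> s_ge0 s0; pose s' := [seq (cq.1, cq.2 %% p) | cq <- s & cq.1 != 0].
  have s'0 : ez (weighted_sum s') = 0.
    rewrite -s0 /weighted_sum big_map big_filter big_mkcond !(big_morph ez ezD (ezC 0)).
    apply: eq_bigr => -[c q] _ /=; have [->|_] /= := eqVneq c 0; first by rewrite scale0r.
    by rewrite !ezZ ez_mod.
  have p_dvd : p %| weighted_sum s'.
    apply: p_irr; apply/negP; rewrite -(coprimep_map val') => /coprimep_root /(_ pz).
    by rewrite -/(ez _) s'0 eqxx.
  move=> [c q] /= scq; have [->|c_neq0] := eqVneq c 0; first by rewrite scale0r ezC.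
  rewrite ezZ -ez_mod (_ : q %% p = 0) ?ezC ?expr0n ?mulr0 //.
  have s'_cq : (c, q %% p) \in s' by apply/mapP; exists (c, q) => //; rewrite mem_filter c_neq0.
  have s'P dr : dr \in s' -> 0 < dr.1 /\ (size dr.2 < size p)%N.
    move=> /mapP[er]; rewrite mem_filter => /andP[e_neq0 /s_ge0 e_ge0 ->] /=.
    by rewrite lt_def e_neq0 e_ge0 ltn_modp.
  have [pa|pa] := ltrP p.[a] 0.
    apply: (weighted_sum_indivisible (a := a) (b := b)) s'P p_dvd _ s'_cq => //.
      by rewrite pa; move: pab; rewrite nmulr_rlt0.
    by move=> r lt_rp /andP[ra rb]; apply: p_min; rewrite // mulr_le0_ge0.
  have {}pa : 0 < p.[a] by rewrite lt_def pa andbT -rootE p_noroot.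
  apply: (weighted_sum_indivisible (a := b) (b := a)) s'P p_dvd _ s'_cq => //.
    by rewrite pa andbT; move: pab; rewrite pmulr_rlt0.
  by move=> r lt_rp /andP[rb ra]; apply: p_min; rewrite // mulr_ge0_le0.
pose D : set K := [set x | exists2 s : seq (O * {poly O}),
  (forall cq, cq \in s -> 0 <= cq.1) & x = ez (weighted_sum s)].
have Dsqr c q : 0 <= c -> D (ez (c *: q ^+ 2)).
  move=> c_ge0; exists [:: (c, q)]; last by rewrite /weighted_sum big_seq1.
  by move=> cq; rewrite inE => /eqP->.
have D_cone : ordering_cone D.
  split.
  - move=> _ _ [s1 s1_ge0 ->] [s2 s2_ge0 ->]; exists (s1 ++ s2).
      by move=> cq; rewrite mem_cat => /orP[/s1_ge0|/s2_ge0].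
    by rewrite weighted_sum_cat ezD.
  - move=> _ _ [s1 s1_ge0 ->] [s2 s2_ge0 ->].
    exists [seq (c1.1 * c2.1, c1.2 * c2.2) | c1 <- s1, c2 <- s2].
      move=> _ /allpairsP[[c1 c2] [/s1_ge0 ? /s2_ge0 ? ->]]; exact: mulr_ge0.
    by rewrite -ezM weighted_sumM.
  - move=> _ _ [s1 _ ->] [s2 _ ->]; rewrite -ezN -ezD.
    rewrite (_ : _ ^+ 2 = ez (1 *: (weighted_sum s1 - weighted_sum s2) ^+ 2)).
      exact: Dsqr.
    by rewrite scale1r !expr2 ezM.
  - by have := Dsqr 1 1 ler01; rewrite expr1n scale1r ezC.
  - move=> _ [s1 s1_ge0 ->] [s2 s2_ge0 e].
    rewrite /weighted_sum (big_morph ez ezD (ezC 0)).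
    rewrite big_seq big1 // => cq scq; apply: (vanish (s1 ++ s2)).
    + by move=> ? ; rewrite mem_cat => /orP[/s1_ge0|/s2_ge0].
    + by rewrite weighted_sum_cat ezD -e subrr.
    + by rewrite mem_cat scq.
(* By maximality [D] is contained in [C]. So the squares of [(z + 1) / 2] and [(z - 1) / 2] lie in
   [C], and their difference [z] lies in [C - C], where [p] has no root. *)
apply: (lift_root p_noroot pz).
have subCD : C `<=` D.
  move=> c /real_carrier_surj[x x_ge0 <-].
  by have := Dsqr x 1 x_ge0; rewrite expr1n alg_polyC ezC.
have DC q : C ((ez q) ^+ 2).
  by apply: (C_max D_cone subCD); have := Dsqr 1 q ler01; rewrite scale1r !expr2 ezM.
have ezV2 q : ez ((2^-1)%:P * q) = 2^-1 * ez q by rewrite ezM ezC fmorphV rmorph_nat.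
have ez1 : ez 1 = 1 by rewrite ezC rmorph1.
by apply: E_half; [have := DC ((2^-1)%:P * ('X + 1)) | have := DC ((2^-1)%:P * ('X - 1))];
  rewrite ezV2 ezD ?ezN ezX ez1.
Qed.

(** [real_carrier_root] does not locate its root. A root outside the interval is divided out, and
    induction applies to the quotient, or to its opposite if the root lies to the right. *)
Lemma real_carrier_closed : Num.real_closed_axiom O.
Proof.
move=> p a b le_ab; have [n] := ubnP (size p); elim: n p => // n IHn p le_pn /andP[pa pb].
have [pa0|pa0] := eqVneq p.[a] 0; first by exists a; rewrite ?lexx ?le_ab // rootE pa0.
have [pb0|pb0] := eqVneq p.[b] 0; first by exists b; rewrite ?lexx ?le_ab // rootE pb0.
have {}pa : p.[a] < 0 by rewrite lt_def eq_sym pa0.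
have {}pb : 0 < p.[b] by rewrite lt_def pb0.
have [|r pr] := @real_carrier_root p a b; first by rewrite nmulr_rlt0.
have [/andP[ar rb]|nr] := boolP (a <= r <= b); first by exists r; rewrite ?ar.
have [q def_p] := factor_theorem _ _ pr.
have q_neq0 : q != 0.
  by apply: contraTneq pa => q0; rewrite def_p q0 mul0r horner0 ltxx.
have lt_qn : (size q < n)%N.
  by move: le_pn; rewrite def_p size_Mmonic ?monicXsubC // size_XsubC addn2.
have root_q x : root q x -> root p x by rewrite def_p rootM => ->.
move: pa pb; rewrite def_p !hornerM !hornerXsubC => pa pb.
move: nr; rewrite negb_and -!ltNge => /orP[lt_ra|lt_br].
  have ra : 0 < a - r by rewrite subr_gt0.
  have rb : 0 < b - r by rewrite subr_gt0 (lt_le_trans lt_ra).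
  have [|x ab_x /root_q px] := IHn q lt_qn; last by exists x; rewrite -?def_p.
  by move: pa pb; rewrite pmulr_llt0 // pmulr_lgt0 // => /ltW -> /ltW ->.
have ra : a - r < 0 by rewrite subr_lt0 (le_lt_trans le_ab).
have rb : b - r < 0 by rewrite subr_lt0.
have [||x ab_x] := IHn (- q); first by rewrite size_polyN.
  rewrite !hornerN oppr_le0 oppr_ge0.
  by move: pa pb; rewrite nmulr_llt0 // nmulr_lgt0 // => /ltW -> /ltW ->.
by rewrite rootN => /root_q px; exists x; rewrite -?def_p.
Qed.

HB.instance Definition _ := Num.RealField_isClosed.Build real_carrier real_carrier_closed.

Lemma maximal_cone_rcf : exists (O' : rcfType) (iota : {rmorphism O' -> K}),
  forall c, C c -> exists2 x : O', 0 <= x & iota x = c.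
Proof. by exists real_carrier, val => c /real_carrier_surj. Qed.

End MaximalCone.

Lemma ordering_cone_rcf (K : fieldType) (C : set K) :
    (forall p : {poly K}, size p != 1%N -> exists x, root p x) -> ordering_cone C ->
  exists (O : rcfType) (iota : {rmorphism O -> K}),
    forall c, C c -> exists2 x : O, 0 <= x & iota x = c.
Proof.
move=> K_closed C_cone; have [F [A FA] FP Ftot|M [M_cone CM M_max]] := Zorn_above C_cone.
  have F2 := chain_bigcup2 Ftot.
  split.
  - move=> x y Fx Fy; have [X [FX Xx Xy]] := F2 x y Fx Fy.
    by exists X => //; apply: (coneD (FP X FX)).
  - move=> x y Fx Fy; have [X [FX Xx Xy]] := F2 x y Fx Fy.
    by exists X => //; apply: (coneM (FP X FX)).
  - move=> x y Fx Fy; have [X [FX Xx Xy]] := F2 x y Fx Fy.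
    by exists X => //; apply: (cone_sqrB (FP X FX)).
  - by exists A => //; apply: cone1 (FP A FA).
  - move=> x Fx Fy; have [X [FX Xx Xy]] := F2 _ _ Fx Fy.
    exact: (cone_anti (FP X FX)).
have [O [iota iotaP]] := maximal_cone_rcf K_closed M_cone M_max.
by exists O, iota => c /CM/iotaP.
Qed.

(** [K] is an algebraic closure of the fraction field of the quotient by [I]. The closure is built
    from a countable field, whence the countable [A]. *)
Lemma prime_ideal_embedding (A : countIdomainType) (I : {pred A}) :
    idealr_closed I -> prime_idealr_closed I ->
  exists (K : fieldType) (phi : {rmorphism A -> K}),
    (forall p : {poly K}, size p != 1%N -> exists x, root p x) /\
    (forall a, (phi a == 0) = (a \in I)).
Proof.
move=> I_ideal I_prime.
pose J : PrimeIdealr.type A := HB.pack (I : A -> bool)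
  (isIdealr.Build A I I_ideal) (isPrimeIdealrClosed.Build A I I_prime).
pose unit (x : {ideal_quot J}) := `[< exists y, y * x = 1 >].
pose inv (x : {ideal_quot J}) := if pselect (exists y, y * x = 1) is left h
  then projT1 (cid h) else x.
have mulV : {in unit, left_inverse 1 inv *%R}.
  by move=> x /asboolP ux; rewrite /inv; case: pselect => // h; case: (cid h).
have unitP x y : y * x = 1 -> unit x by move=> yx; apply/asboolP; exists y.
have inv_out : {in [predC unit], inv =1 id}.
  by move=> x /asboolPn nux; rewrite /inv; case: pselect.
pose QU : comUnitRingType := HB.pack {ideal_quot J}
  (GRing.ComNzRing_hasMulInverse.Build {ideal_quot J} mulV unitP inv_out).
pose QD : idomainType := HB.pack {ideal_quot J} QU
  (GRing.ComUnitRing_isIntegral.Build QU (@Quotient.rquot_IdomainAxiom A J)).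
pose proj : {rmorphism A -> QD} := (\pi_({ideal_quot J}))%qT.
pose code (x : {fraction QD}) : A * A :=
  (repr (frac (repr x)).1, repr (frac (repr x)).2).
pose decode (ab : A * A) : {fraction QD} :=
  (\pi_({fraction QD}) (Ratio (proj ab.1) (proj ab.2)))%qT.
have codeK : cancel code decode.
  by move=> x; rewrite /decode /code /proj /= !reprK Ratio_numden reprK.
pose F : countFieldType := HB.pack {fraction QD} (CanIsCountable codeK).
have [K [emb _]] := countable_algebraic_closure F.
exists K, (emb \o @FracField.tofrac QD \o proj); split=> [p|a].
  by move/closed_rootP.
rewrite /= fmorph_eq0 tofrac_eq0 -(rmorph0 proj) -[a in RHS]subr0.
by rewrite -[RHS]/(a - 0 \in J) Quotient.idealrBE.
Qed.

(** * Preorderings and prime cones *)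

Record preordering (B : comNzRingType) (P : set B) : Prop := Preordering {
  preorderingD : forall x y, P x -> P y -> P (x + y);
  preorderingM : forall x y, P x -> P y -> P (x * y);
  preordering_sqr : forall x, P (x ^+ 2) }.

(** A point of the real spectrum of [B]: an ordering of the quotient by the prime ideal of all [x]
    with both [x] and [- x] in [P]. *)
Record prime_cone (B : comNzRingType) (P : set B) : Prop := PrimeCone {
  prime_coneD : forall x y, P x -> P y -> P (x + y);
  prime_coneM : forall x y, P x -> P y -> P (x * y);
  prime_cone_total : forall x, P x \/ P (- x);
  prime_coneN1 : ~ P (-1);
  prime_cone_prime : forall x y, P (x * y) -> P (- (x * y)) ->
    (P x /\ P (- x)) \/ (P y /\ P (- y)) }.

(** For a preordering [P] this is the one generated by [P] and [x], as [x ^ 2] is already in [P]. *)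
Definition adjoin (B : comNzRingType) (P : set B) (x : B) : set B :=
  [set z | exists s t, [/\ P s, P t & z = s + t * x]].

Lemma preordering0 (B : comNzRingType) (P : set B) : preordering P -> P 0.
Proof. by move=> /preordering_sqr/(_ 0); rewrite expr0n. Qed.

Lemma preordering1 (B : comNzRingType) (P : set B) : preordering P -> P 1.
Proof. by move=> /preordering_sqr/(_ 1); rewrite expr1n. Qed.

Lemma sub_adjoin (B : comNzRingType) (P : set B) x : preordering P -> P `<=` adjoin P x.
Proof.
by move=> P_pre z Pz; exists z, 0; rewrite mul0r addr0; split=> //; apply: preordering0.
Qed.

Lemma adjoin_self (B : comNzRingType) (P : set B) x : preordering P -> adjoin P x x.
Proof.
move=> P_pre; exists 0, 1; rewrite mul1r add0r.
by split=> //; [apply: preordering0|apply: preordering1].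
Qed.

Lemma preordering_adjoin (B : comNzRingType) (P : set B) x :
  preordering P -> preordering (adjoin P x).
Proof.
move=> P_pre; have PD := preorderingD P_pre; have PM := preorderingM P_pre.
have Psq := preordering_sqr P_pre; split.
- move=> _ _ [s [t [Ps Pt ->]]] [s' [t' [Ps' Pt' ->]]].
  by exists (s + s'), (t + t'); split; [exact: PD|exact: PD|ring].
- move=> _ _ [s [t [Ps Pt ->]]] [s' [t' [Ps' Pt' ->]]].
  exists (s * s' + t * t' * x ^+ 2), (s * t' + t * s'); split; last by ring.
    by apply: (PD); apply: (PM) => //; apply: (PM).
  by apply: (PD); apply: (PM).
- by move=> z; apply: sub_adjoin.
Qed.

Lemma preordering_prime_cone (B : comNzRingType) (T : set B) :
    preordering T -> ~ T (-1) ->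
  exists P, prime_cone P /\ T `<=` P.
Proof.
move=> T_pre T_N1.
have [|F [A FA] FP Ftot|P [[P_pre P_N1] TP P_max]] :=
    @Zorn_above B [set P | preordering P /\ ~ P (-1)] T; first by [].
  have F2 := chain_bigcup2 Ftot.
  split; last by move=> [X FX X_N1]; have [_] := FP X FX.
  split.
  - move=> x y Fx Fy; have [X [FX Xx Xy]] := F2 x y Fx Fy.
    by exists X => //; apply: (preorderingD (FP X FX).1).
  - move=> x y Fx Fy; have [X [FX Xx Xy]] := F2 x y Fx Fy.
    by exists X => //; apply: (preorderingM (FP X FX).1).
  - by move=> x; exists A => //; apply: preordering_sqr (FP A FA).1 _.
have PD := preorderingD P_pre; have PM := preorderingM P_pre.
have Psq := preordering_sqr P_pre.
have P_gen x : ~ P x -> exists s t, [/\ P s, P t & - t * x = 1 + s].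
  move=> nPx; have D_pre := preordering_adjoin x P_pre.
  have [[s [t [Ps Pt e]]]|D_N1] := pselect (adjoin P x (-1)); last first.
    case: nPx; apply: (P_max (adjoin P x)) => //; first exact: sub_adjoin.
    exact: adjoin_self.
  exists s, t; split=> //.
  have -> : - t * x = s - (s + t * x) by ring.
  by rewrite -e; ring.
have P_total x : P x \/ P (- x).
  (* Multiplying [- t * x = 1 + s] by [t' * x = 1 + s'] exhibits [-1] in [P]; primality of the
     support follows from a similar product. *)
  apply: contrapT => /not_orP[/P_gen[s [t [Ps Pt e]]] /P_gen[s' [t' [Ps' Pt' e']]]].
  apply: P_N1; rewrite (_ : -1 = s + s' + s * s' + t * t' * x ^+ 2); last first.
    have -> : t * t' * x ^+ 2 = - ((- t * x) * (- t' * - x)) by ring.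
    by rewrite e e'; ring.
  by apply: (PD); [apply: (PD); [apply: (PD)|apply: (PM)]|apply: (PM) => //; apply: (PM)].
have supp_prime x y : P (x * y) -> P (- (x * y)) -> ~ P (- x) -> ~ P (- y) -> False.
  move=> Pxy PNxy /P_gen[s [t [Ps Pt e]]] /P_gen[s' [t' [Ps' Pt' e']]].
  apply: P_N1; rewrite (_ : -1 = s + s' + s * s' + t * t' * - (x * y)); last first.
    have -> : t * t' * - (x * y) = - ((- t * - x) * (- t' * - y)) by ring.
    by rewrite e e'; ring.
  by apply: (PD); [apply: (PD); [apply: (PD)|apply: (PM)]|apply: (PM) => //; apply: (PM)].
exists P; split=> //; split=> // x y Pxy PNxy.
apply: contrapT => /not_orP[nx ny].
have [Px|PNx] := P_total x; have [Py|PNy] := P_total y.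
- apply: (supp_prime x y) => //.
  + by move=> ?; apply: nx.
  + by move=> ?; apply: ny.
- apply: (supp_prime x (- y)); rewrite ?mulrN ?opprK //.
  + by move=> ?; apply: nx.
  + by move=> ?; apply: ny.
- apply: (supp_prime (- x) y); rewrite ?mulNr ?opprK //.
  + by move=> ?; apply: nx.
  + by move=> ?; apply: ny.
- apply: (supp_prime (- x) (- y)); rewrite ?mulrNN ?opprK //.
  + by move=> ?; apply: nx.
  + by move=> ?; apply: ny.
Qed.

(** [Q] orders the image of [A] in the field [K], and this ordering extends to a real closed
    subfield [O]. As every [a] lies in [Q] up to sign, [phi] takes its values in [O]. *)
Lemma prime_cone_rcf (A : countIdomainType) (Q : set A) : prime_cone Q ->
  exists (O : rcfType) (phi : {rmorphism A -> O}), forall a, (0 <= phi a) <-> Q a.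
Proof.
move=> Qc; have QD := prime_coneD Qc; have QM := prime_coneM Qc.
have Q_total := prime_cone_total Qc.
have Qsq x : Q (x ^+ 2).
  rewrite expr2; have [?|?] := Q_total x; first exact: QM.
  by rewrite -mulrNN; apply: (QM).
have Q0 : Q 0 by have := Qsq 0; rewrite expr0n.
have Q1 : Q 1 by have := Qsq 1; rewrite expr1n.
pose I : {pred A} := fun x => `[< Q x /\ Q (- x) >].
have IP x : x \in I <-> Q x /\ Q (- x) by split=> /asboolP.
have IM a x : Q x /\ Q (- x) -> Q (a * x) /\ Q (- (a * x)).
  move=> [Qx QNx]; have [Qa|QNa] := Q_total a.
    by rewrite -mulrN; split; apply: (QM).
  by rewrite -{1}mulrNN -mulNr; split; apply: (QM).
have I_ideal : idealr_closed I.
  split; first by apply/IP; rewrite oppr0.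
    by apply/negP => /IP[_]; apply: prime_coneN1 Qc.
  move=> a x y /IP/(IM a)[Qx QNx] /IP[Qy QNy]; apply/IP.
  by rewrite opprD; split; apply: (QD).
have I_prime : prime_idealr_closed I.
  move=> x y /IP[Qxy QNxy]; apply/orP.
  by have [?|?] := prime_cone_prime Qc Qxy QNxy; [left|right]; apply/IP.
have [K [phi [K_closed phi0]]] := prime_ideal_embedding I_ideal I_prime.
have phi_eq0 a : phi a = 0 <-> Q a /\ Q (- a).
  by rewrite -IP -phi0; split=> [->|/eqP].
have cone : ordering_cone [set phi a | a in Q].
  split.
  - by move=> _ _ [a Qa <-] [b Qb <-]; exists (a + b); rewrite ?rmorphD //; apply: (QD).
  - by move=> _ _ [a Qa <-] [b Qb <-]; exists (a * b); rewrite ?rmorphM //; apply: (QM).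
  - by move=> _ _ [a _ <-] [b _ <-]; exists ((a - b) ^+ 2); rewrite ?rmorphXn ?rmorphB.
  - by exists 1; rewrite ?rmorph1.
  move=> _ [a Qa <-] [b Qb e]; apply/phi_eq0; split=> //.
  have [] : Q (a + b) /\ Q (- (a + b)) by apply/phi_eq0; rewrite rmorphD e subrr.
  by move=> _ /QD/(_ Qb); rewrite opprD addrNK.
have [O [iota iotaP]] := ordering_cone_rcf K_closed cone.
have lift a : exists x, iota x = phi a.
  have [Qa|QNa] := Q_total a.
    by have [|x _ xa] := iotaP (phi a); [exists a|exists x].
  have [|x _ xa] := iotaP (- phi a); first by exists (- a); rewrite ?rmorphN.
  by exists (- x); rewrite rmorphN xa opprK.
have [psi psiE] := choice lift.
have iota_inj : injective iota by apply: fmorph_inj.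
have psiB : zmod_morphism psi.
  by move=> a b; apply: iota_inj; rewrite rmorphB !psiE rmorphB.
have psiM : monoid_morphism psi.
  by split=> [|a b]; apply: iota_inj; rewrite ?rmorphM !psiE ?rmorphM ?rmorph1.
pose Psi : {rmorphism A -> O} := HB.pack psi
  (GRing.isZmodMorphism.Build A O psi psiB) (GRing.isMonoidMorphism.Build A O psi psiM).
exists O, Psi.
have Psi_ge0 a : Q a -> 0 <= Psi a.
  move=> Qa; have [|x x_ge0 xa] := iotaP (phi a); first by exists a.
  by rewrite (_ : Psi a = x) //; apply: iota_inj; rewrite psiE.
move=> a; split=> [a_ge0|]; last exact: Psi_ge0.
have [//|QNa] := Q_total a.
have /phi_eq0[] // : phi a = 0.
rewrite -psiE -[psi a]/(Psi a) (_ : Psi a = 0) ?rmorph0 //; apply/eqP.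
by rewrite eq_le a_ge0 andbT -oppr_ge0 -rmorphN Psi_ge0.
Qed.

(** ** Transfer of sign conditions to the real numbers *)

(* The polynomials over [Z] in [r] variables, iterating univariate polynomials
   because these form a countable ring. *)
Fixpoint itpoly (r : nat) : countIdomainType :=
  if r is r'.+1 then {poly itpoly r'} : countIdomainType else int.

Section Evaluation.
Variables (B : comNzRingType) (w : nat -> B).

Fixpoint itpoly_eval (r : nat) : {rmorphism itpoly r -> B} :=
  match r return {rmorphism itpoly r -> B} with
  | 0 => (intmul 1 : {rmorphism int -> B})
  | r'.+1 => (horner_eval (w r') \o map_poly (itpoly_eval r')
               : {rmorphism {poly itpoly r'} -> B})
  end.

Lemma itpoly_evalS r (f : itpoly r.+1) :
  itpoly_eval r.+1 f = (map_poly (itpoly_eval r) f).[w r].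
Proof. by []. Qed.

End Evaluation.

Lemma eq_itpoly_eval (B : comNzRingType) (w w' : nat -> B) r :
  (forall i, (i < r)%N -> w i = w' i) -> itpoly_eval w r =1 itpoly_eval w' r.
Proof.
elim: r => [|r IHr] // ww' f; rewrite !itpoly_evalS ww' //.
by congr _.[_]; apply: eq_map_poly => a; apply: IHr => i /ltnW/ww'.
Qed.

Lemma itpoly_var r j : (j < r)%N ->
  exists X : itpoly r, forall (B : comNzRingType) (w : nat -> B), itpoly_eval w r X = w j.
Proof.
elim: r => // r IHr; rewrite ltnS leq_eqVlt => /orP[/eqP->|/IHr[X XE]].
  by exists ('X : {poly itpoly r}) => B w; rewrite itpoly_evalS map_polyX hornerX.
by exists (X%:P : {poly itpoly r}) => B w; rewrite itpoly_evalS map_polyC hornerC; exact: XE.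
Qed.

(** [transfer_sgz] eliminates the last variable at the price of finitely many sign conditions [H] on
    the others, to which induction applies. The first [r] variables keep the values [c]. *)
Lemma transfer_itpoly (O1 O2 : rcfType) (w1 : nat -> O1) (c : nat -> O2) r k :
    (forall f, sgz (itpoly_eval c r f) = sgz (itpoly_eval w1 r f)) ->
  forall F : seq (itpoly (k + r)), exists w2 : nat -> O2,
    (forall i, (i < r)%N -> w2 i = c i) /\
    (forall f, f \in F ->
       sgz (itpoly_eval w2 (k + r) f) = sgz (itpoly_eval w1 (k + r) f)).
Proof.
move=> agree_r; elim: k => [|k IHk] F; first by exists c.
have [H hH] := transfer_sgz (itpoly_eval w1 (k + r)) F (w1 (k + r)).
have [w2 [w2c w2H]] := IHk H.
have [x xF] := hH _ (itpoly_eval w2 (k + r)) w2H.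
pose w2' i := if i == (k + r)%N then x else w2 i.
exists w2'; split=> [i ir|f Ff].
  by rewrite /w2' ltn_eqF ?w2c // (leq_trans ir) // leq_addl.
apply: etrans (xF f Ff).
rewrite -[LHS]/(sgz (map_poly (itpoly_eval w2' (k + r)) f).[w2' (k + r)%N]).
rewrite /w2' eqxx; congr (sgz _.[_]).
by apply: eq_map_poly => a; apply: eq_itpoly_eval => i ir; rewrite ltn_eqF.
Qed.

Lemma rmorph_itpoly_eval (B B' : comNzRingType) (h : {rmorphism B -> B'}) (w : nat -> B) r f :
  h (itpoly_eval w r f) = itpoly_eval (h \o w) r f.
Proof.
elim: r f => [|r IHr] f; first by rewrite /= rmorph_int.
rewrite !itpoly_evalS -horner_map -map_poly_comp; congr _.[_].
by apply: eq_map_poly => a; rewrite /= IHr.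
Qed.

Lemma itpoly_rmorphE (B : comNzRingType) r (phi : {rmorphism itpoly r -> B}) :
  exists w : nat -> B, phi =1 itpoly_eval w r.
Proof.
elim: r phi => [|r IHr] phi; first by exists (fun=> 0) => f; rewrite /= -{1}[f]intz rmorph_int.
have [w phiE] := IHr (phi \o (@polyC (itpoly r)) : {rmorphism itpoly r -> B}).
pose w' i := if i == r then phi ('X : {poly itpoly r}) else w i.
exists w' => f; rewrite itpoly_evalS /w' eqxx.
rewrite (eq_map_poly (g := phi \o (@polyC (itpoly r)))) => [|a]; last first.
  by rewrite phiE; apply: eq_itpoly_eval => i ir; rewrite ltn_eqF.
move: f; apply: (@poly_ind (itpoly r)) => [|p a IHp]; first by rewrite !rmorph0 horner0.
by rewrite !rmorphD !rmorphM IHp /= map_polyX map_polyC hornerD hornerMX hornerC.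
Qed.

Lemma itpoly_widen k r (f : itpoly r) :
  exists f' : itpoly (k + r), forall (B : comNzRingType) (w : nat -> B),
    itpoly_eval w (k + r) f' = itpoly_eval w r f.
Proof.
elim: k => [|k [f' IHf]]; first by exists f.
exists (f'%:P : {poly itpoly (k + r)}) => B w.
rewrite -[LHS]/((map_poly (itpoly_eval w (k + r)) f'%:P).[w (k + r)%N]).
by rewrite map_polyC hornerC; apply: IHf.
Qed.

(** Coefficients become variables: the first [size cs] variables stand for [cs], the last [n] for
    those of [f]. One [F] can then be evaluated over several rings. *)
Lemma itpoly_of_mpoly (R : nzRingType) n (cs : seq R) (f : {mpoly R[n]}) :
    (forall m, m \in msupp f -> mcoeff m f \in cs) ->
  exists F : itpoly (n + size cs),
    forall (B : comNzRingType) (h : {rmorphism R -> B}) (w : nat -> B),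
      (forall i, (i < size cs)%N -> w i = h (cs`_i)) ->
      itpoly_eval w _ F = mmap h (fun i : 'I_n => w (size cs + i)%N) f.
Proof.
move=> f_cs.
have var j : exists X : itpoly (n + size cs), (j < n + size cs)%N ->
    forall (B : comNzRingType) (w : nat -> B), itpoly_eval w _ X = w j.
  have [/itpoly_var[X XE]|_] := boolP (j < n + size cs)%N; first by exists X.
  by exists 0.
have [X XE] := choice var.
exists (\sum_(m <- msupp f) X (index (mcoeff m f) cs) *
          \prod_(i < n) X (size cs + i)%N ^+ m i) => B h w w_cs.
rewrite rmorph_sum /mmap; apply: eq_big_seq => m fm.
have lt_m : (index (mcoeff m f) cs < size cs)%N by rewrite index_mem f_cs.
rewrite rmorphM rmorph_prod XE ?(leq_trans lt_m) ?leq_addl //=.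
rewrite w_cs // nth_index ?f_cs //; congr (_ * _); apply: eq_bigr => i _.
by rewrite rmorphXn XE // addnC ltn_add2r.
Qed.

Lemma sgz_eq_iff (O1 O2 : realDomainType) (x : O1) (y : O2) :
  (0 <= x <-> 0 <= y) -> (0 <= - x <-> 0 <= - y) -> sgz x = sgz y.
Proof.
rewrite !oppr_ge0 => xy yx.
have e : (0 <= x) = (0 <= y) by apply/idP/idP => /xy.
have e' : (x <= 0) = (y <= 0) by apply/idP/idP => /yx.
by rewrite /sgz !eq_le !ltNge e e'.
Qed.

(** The Artin-Lang property. With the coefficients of [fs] as extra variables, [P] pulls back to a
    prime cone [Q] on a countable ring, hence to a map into a real closed field, from which signs
    are transferred to [R]. *)
Lemma prime_cone_point (R : rcfType) (n : nat) (P : set {mpoly R[n]}) (fs : seq {mpoly R[n]}) :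
    prime_cone P -> (forall f, f \in fs -> P f) ->
  exists v : 'I_n -> R, forall f, f \in fs -> 0 <= meval v f.
Proof.
move=> Pc fsP.
pose cs := flatten [seq [seq mcoeff m f | m <- msupp f] | f <- fs].
have f_cs f : f \in fs -> forall m, m \in msupp f -> mcoeff m f \in cs.
  move=> ff m fm; apply/flattenP; exists [seq mcoeff m f | m <- msupp f].
    by apply: map_f.
  by apply: map_f.
pose r := size cs; pose c i := cs`_i.
pose C : {rmorphism R -> {mpoly R[n]}} := @mpolyC n R.
pose w (i : nat) : {mpoly R[n]} := if (i < r)%N then C (c i)
  else if insub (i - r)%N is Some j then mpolyX R (mnm1 j) else 0.
have wr i : (i < r)%N -> w i = C (c i) by rewrite /w => ->.
have wX (j : 'I_n) : w (r + j)%N = mpolyX R (mnm1 j).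
  by rewrite /w ltnNge leq_addr addKn insubT //= => lt_j; congr mpolyX; congr mnm1; apply: val_inj.
pose Q := [set f | P (itpoly_eval w (n + r) f)].
have Qc : prime_cone Q.
  split.
  - by move=> x y; rewrite /Q /= rmorphD; apply: prime_coneD.
  - by move=> x y; rewrite /Q /= rmorphM; apply: prime_coneM.
  - by move=> x; rewrite /Q /= rmorphN; apply: prime_cone_total.
  - by rewrite /Q /= rmorphN rmorph1; apply: prime_coneN1.
  - by move=> x y; rewrite /Q /= !rmorphN !rmorphM; apply: prime_cone_prime.
have [O [phi phiP]] := prime_cone_rcf Qc.
have [w1 phiE] := itpoly_rmorphE phi.
(* Nonnegative constants are squares, and a negative one in [P] would give [-1]. Hence expressions
   in the coefficients have the same sign in [R] and in [O]. *)
have PC (a : R) : P (C a) <-> 0 <= a.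
  have Psq x : P (x ^+ 2).
    rewrite expr2; have [?|?] := prime_cone_total Pc x.
      exact: prime_coneM.
    by rewrite -mulrNN; apply: prime_coneM.
  split=> [Pa|a_ge0]; last by rewrite -(sqr_sqrtr a_ge0) rmorphXn; apply: Psq.
  rewrite leNgt; apply/negP => a_lt0; apply: (prime_coneN1 Pc).
  have a_ge0 : 0 <= - a^-1 by rewrite oppr_ge0 invr_le0 ltW.
  rewrite (_ : -1 = C a * C (- a^-1)); last first.
    by rewrite -rmorphM mulrN mulfV ?lt_eqF // rmorphN rmorph1.
  by apply: prime_coneM => //; rewrite -(sqr_sqrtr a_ge0) rmorphXn; apply: Psq.
have agree_r (f : itpoly r) : sgz (itpoly_eval c r f) = sgz (itpoly_eval w1 r f).
  have ge0 (g : itpoly r) : 0 <= itpoly_eval c r g <-> 0 <= itpoly_eval w1 r g.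
    have [g' gE] := itpoly_widen n g.
    rewrite -(gE _ w1) -phiE phiP /Q /= gE -PC rmorph_itpoly_eval.
    by rewrite (eq_itpoly_eval (w' := w)) // => i ir; rewrite wr.
  by apply: sgz_eq_iff; rewrite -?rmorphN; apply: ge0.
have repr f : exists F : itpoly (n + r), f \in fs ->
    forall (B : comNzRingType) (h : {rmorphism R -> B}) (w : nat -> B),
      (forall i, (i < r)%N -> w i = h (c i)) ->
      itpoly_eval w _ F = mmap h (fun i : 'I_n => w (r + i)%N) f.
  have [/f_cs/itpoly_of_mpoly[F FE]|_] := boolP (f \in fs); first by exists F.
  by exists 0.
have [F FE] := choice repr.
have [w2 [w2c w2F]] := transfer_itpoly agree_r [seq F f | f <- fs].
exists (fun i => w2 (r + i)%N) => f ff.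
have -> : meval (fun i : 'I_n => w2 (r + i)%N) f = itpoly_eval w2 _ (F f).
  by rewrite (FE f ff R idfun w2).
rewrite -sgz_ge0 w2F ?map_f // sgz_ge0 -phiE phiP /Q /= (FE f ff _ C w wr).
suff -> : mmap C (fun i : 'I_n => w (r + i)%N) f = f by apply: fsP.
rewrite [RHS]mpolyE /mmap; apply: eq_bigr => m _.
rewrite mul_mpolyC; congr (_ *: _); rewrite -mmap1_id.
by apply: eq_bigr => i _; rewrite wX.
Qed.

(** ** Quadratic modules *)

Definition sum_of_squares (B : comNzRingType) : set B :=
  [set x | exists qs : seq B, x = \sum_(q <- qs) q ^+ 2].

Lemma sum_of_squares_preordering (B : comNzRingType) : preordering (@sum_of_squares B).
Proof.
split=> [_ _ [ps ->] [qs ->]|_ _ [ps ->] [qs ->]|x].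
- by exists (ps ++ qs); rewrite big_cat.
- exists [seq p * q | p <- ps, q <- qs]; rewrite big_allpairs_dep mulr_suml.
  apply: eq_bigr => p _; rewrite mulr_sumr; apply: eq_bigr => q _.
  by rewrite exprMn.
- by exists [:: x]; rewrite big_seq1.
Qed.

Record quadratic_module (B : comNzRingType) (M : set B) : Prop := QuadraticModule {
  quadratic_moduleD : forall x y, M x -> M y -> M (x + y);
  quadratic_module1 : M 1;
  quadratic_module_sqr : forall x y, M y -> M (x ^+ 2 * y) }.

Section QuadraticModule.
Variables (B : comNzRingType) (M : set B).
Hypothesis M_qm : quadratic_module M.
Let MD := quadratic_moduleD M_qm.

Lemma quadratic_module0 : M 0.
Proof. by have := quadratic_module_sqr M_qm 0 (quadratic_module1 M_qm); rewrite expr0n mul0r. Qed.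

Lemma quadratic_module_sos x y : sum_of_squares x -> M y -> M (x * y).
Proof.
move=> [qs ->] My; rewrite mulr_suml; elim/big_ind: _ => [|u v Mu Mv|q _].
- exact: quadratic_module0.
- exact: MD.
- exact: quadratic_module_sqr.
Qed.

Lemma sos_quadratic_module x : sum_of_squares x -> M x.
Proof.
by move=> sx; rewrite -[x]mulr1; apply: quadratic_module_sos => //; apply: quadratic_module1.
Qed.

Lemma quadratic_module_sum (I : Type) (r : seq I) (P : pred I) (F : I -> B) :
  (forall i, P i -> M (F i)) -> M (\sum_(i <- r | P i) F i).
Proof.
move=> MF; elim/big_ind: _ => [|u v Mu Mv|//]; first exact: quadratic_module0.
exact: MD.
Qed.

(** The multipliers of [x] are sums of squares only, as [M] need not be closed under products. *)
Definition qm_adjoin (x : B) : set B :=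
  [set z | exists m s, [/\ M m, sum_of_squares s & z = m + s * x]].

Lemma quadratic_module_adjoin x : quadratic_module (qm_adjoin x).
Proof.
have sosP := sum_of_squares_preordering B.
split=> [_ _ [m [s [Mm ss ->]]] [m' [s' [Mm' ss' ->]]]||y _ [m [s [Mm ss ->]]]].
- exists (m + m'), (s + s'); split; [exact: MD|exact: preorderingD|by ring].
- exists 1, 0; rewrite mul0r addr0; split=> //; first exact: quadratic_module1.
  exact: preordering0.
- exists (y ^+ 2 * m), (y ^+ 2 * s); split; [exact: quadratic_module_sqr| |by ring].
  by apply: preorderingM => //; apply: preordering_sqr.
Qed.

Lemma sub_qm_adjoin x : M `<=` qm_adjoin x.
Proof.
move=> m Mm; exists m, 0; rewrite mul0r addr0; split=> //.
exact: preordering0 (sum_of_squares_preordering _).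
Qed.

Lemma qm_adjoin_self x : qm_adjoin x x.
Proof.
exists 0, 1; rewrite mul1r add0r; split=> //; first exact: quadratic_module0.
exact: preordering1 (sum_of_squares_preordering _).
Qed.

End QuadraticModule.

Lemma preordering_quadratic_module (B : comNzRingType) (P : set B) :
  preordering P -> quadratic_module P.
Proof.
move=> P_pre; split=> [|//|x y Py]; [exact: preorderingD|exact: preordering1|].
by apply: preorderingM => //; apply: preordering_sqr.
Qed.

(** * Polynomials bounded modulo a quadratic module *)

Section Archimedean.
Variables (R : realType) (n : nat) (M : set {mpoly R[n]}).
Hypothesis M_qm : quadratic_module M.
Implicit Types (p q : {mpoly R[n]}).

Let C : {rmorphism R -> {mpoly R[n]}} := @mpolyC n R.
Let MD := quadratic_moduleD M_qm.

Lemma quadratic_module_const (c : R) p : 0 <= c -> M p -> M (C c * p).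
Proof.
by move=> c_ge0 Mp; rewrite -(sqr_sqrtr c_ge0) rmorphXn; apply: quadratic_module_sqr.
Qed.

Lemma quadratic_module_ge0 (c : R) : 0 <= c -> M (C c).
Proof.
by move=> c_ge0; rewrite -[C c]mulr1; apply: quadratic_module_const => //; apply: quadratic_module1.
Qed.

(* [k ^ 2 - p ^ 2 = ((k - p) ^ 2 (k + p) + (k + p) ^ 2 (k - p)) / (2 k)] *)
Lemma quadratic_module_sqr_bound (k : R) p : 0 < k ->
  M (C k - p) -> M (C k + p) -> M (C (k ^+ 2) - p ^+ 2).
Proof.
move=> k_gt0 Mm Mp.
have e : C (k ^+ 2) - p ^+ 2 =
    C ((2 * k)^-1) * ((C k - p) ^+ 2 * (C k + p) + (C k + p) ^+ 2 * (C k - p)).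
  rewrite (_ : _ * (C k + p) + _ = C (2 * k) * (C (k ^+ 2) - p ^+ 2)); last first.
    by rewrite rmorphXn rmorphM rmorph_nat; ring.
  by rewrite mulrA -rmorphM mulVf ?rmorph1 ?mul1r // mulf_neq0 // gt_eqF.
rewrite e; apply: quadratic_module_const; first by rewrite invr_ge0 mulr_ge0 // ltW.
by apply: MD; apply: quadratic_module_sqr.
Qed.

(** The bounded elements form a subring containing the constants, so boundedness has to be checked
    on the variables only. *)
Definition module_bounded p := exists k : R, M (C k - p) /\ M (C k + p).

Lemma module_bounded_pos p : module_bounded p ->
  exists k : R, [/\ 0 < k, M (C k - p) & M (C k + p)].
Proof.
move=> [k [Mm Mp]]; exists (`|k| + 1); split; first by rewrite ltr_pwDr.
- rewrite (_ : _ - p = C (`|k| + 1 - k) + (C k - p)); last by rewrite rmorphB; ring.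
  by apply: (MD) => //; apply: quadratic_module_ge0; rewrite subr_ge0 ler_wpDr // ler_norm.
- rewrite (_ : _ + p = C (`|k| + 1 - k) + (C k + p)); last by rewrite rmorphB; ring.
  by apply: (MD) => //; apply: quadratic_module_ge0; rewrite subr_ge0 ler_wpDr // ler_norm.
Qed.

Lemma module_boundedC c : module_bounded (C c).
Proof.
exists `|c|; rewrite -rmorphB -rmorphD.
split; apply: quadratic_module_ge0; first by rewrite subr_ge0 ler_norm.
by rewrite -[X in _ + X]opprK subr_ge0 -normrN ler_norm.
Qed.

Lemma module_boundedD p q : module_bounded p -> module_bounded q -> module_bounded (p + q).
Proof.
move=> [k [km kp]] [l [lm lp]]; exists (k + l); split.
  by rewrite (_ : _ - _ = (C k - p) + (C l - q)); [exact: MD|rewrite rmorphD; ring].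
by rewrite (_ : _ + _ = (C k + p) + (C l + q)); [exact: MD|rewrite rmorphD; ring].
Qed.

Lemma module_boundedN p : module_bounded p -> module_bounded (- p).
Proof. by move=> [k [km kp]]; exists k; rewrite opprK. Qed.

Lemma module_bounded_sqr p : module_bounded p -> module_bounded (p ^+ 2).
Proof.
move=> /module_bounded_pos[k [k_gt0 km kp]]; exists (k ^+ 2); split.
  exact: quadratic_module_sqr_bound.
apply: (MD); first by apply: quadratic_module_ge0; rewrite sqr_ge0.
by apply: sos_quadratic_module => //; apply: preordering_sqr; apply: sum_of_squares_preordering.
Qed.

Lemma module_boundedZ c p : module_bounded p -> module_bounded (C c * p).
Proof.
wlog c_ge0 : c / 0 <= c => [hw|].
  have [/hw//|/ltW] := lerP 0 c; rewrite -oppr_ge0 => c_ge0 /(hw _ c_ge0).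
  by rewrite rmorphN mulNr => /module_boundedN; rewrite opprK.
move=> [k [km kp]]; exists (c * k); rewrite rmorphM -mulrBr -mulrDr.
by split; apply: quadratic_module_const.
Qed.

Lemma module_boundedM p q : module_bounded p -> module_bounded q -> module_bounded (p * q).
Proof.
move=> bp bq.
rewrite (_ : p * q = C (4^-1) * ((p + q) ^+ 2 + - (p + - q) ^+ 2)); last first.
  have -> : (p + q) ^+ 2 + - (p + - q) ^+ 2 = C 4 * (p * q) by rewrite rmorph_nat; ring.
  by rewrite mulrA -rmorphM mulVf ?pnatr_eq0 // rmorph1 mul1r.
apply/module_boundedZ/module_boundedD; first exact/module_bounded_sqr/module_boundedD.
by apply/module_boundedN/module_bounded_sqr/module_boundedD => //; apply: module_boundedN.
Qed.

Lemma module_bounded_all : (forall i : 'I_n, module_bounded (mpolyX R (mnm1 i))) ->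
  forall p, module_bounded p.
Proof.
move=> bX p; rewrite [p]mpolyE; elim/big_ind: _ => [||m _].
- by rewrite -(rmorph0 C); apply: module_boundedC.
- exact: module_boundedD.
rewrite -mul_mpolyC; apply: module_boundedM; first exact: module_boundedC.
rewrite -mmap1_id; rewrite /mmap1; elim/big_ind: _ => [||i _].
- by rewrite -(rmorph1 C); apply: module_boundedC.
- exact: module_boundedM.
elim: (m i) => [|k IHk]; first by rewrite expr0 -(rmorph1 C); apply: module_boundedC.
by rewrite exprS; apply: module_boundedM.
Qed.

Lemma module_bounded_ball (N : R) :
    M (C N - \sum_(i < n) mpolyX R (mnm1 i) ^+ 2) -> forall p, module_bounded p.
Proof.
move=> ball; apply: module_bounded_all => i; set X := mpolyX R (mnm1 i).
have XN : M (C N - X ^+ 2).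
  rewrite (_ : _ - _ = C N - \sum_(i < n) mpolyX R (mnm1 i) ^+ 2 +
    \sum_(j < n | j != i) mpolyX R (mnm1 j) ^+ 2).
    apply: (MD) => //; apply: quadratic_module_sum => // j _.
    by apply: sos_quadratic_module => //; apply: preordering_sqr; apply: sum_of_squares_preordering.
  by rewrite (bigD1 i) //= opprD addrA subrK.
(* Completing the square; [e = - 1 / 2] and [e = 1 / 2] give the two bounds on [X]. *)
have half e : e ^+ 2 = 4^-1 -> M (C (N + 4^-1) + C (2 * e) * X).
  move=> e2; rewrite (_ : _ + _ = C N - X ^+ 2 + (X + C e) ^+ 2).
    apply: (MD) => //; apply: sos_quadratic_module => //.
    by apply: preordering_sqr; apply: sum_of_squares_preordering.
  by rewrite -e2 rmorphD rmorphXn rmorphM rmorph_nat; ring.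
exists (N + 4^-1); split.
  have := half (- 2^-1); rewrite mulrN mulfV ?pnatr_eq0 // rmorphN rmorph1 mulN1r.
  by apply; rewrite sqrrN expr2 -invfM -natrM.
have := half (2^-1); rewrite mulfV ?pnatr_eq0 // rmorph1 mul1r.
by apply; rewrite expr2 -invfM -natrM.
Qed.

End Archimedean.

(* Woermann's argument: the emptiness certificate [p * u = 1 + q] shows that [T]
   and the archimedean preordering obtained by adjoining [u] are comparable. *)
Lemma preordering_ball (R : realType) (n : nat) (psi : {mpoly R[n]}) (N : R) :
    0 <= N ->
    (forall v : 'I_n -> R, 0 <= meval v psi -> \sum_(i < n) v i ^+ 2 < N) ->
  exists k : R, adjoin (@sum_of_squares {mpoly R[n]}) psi
    ((mpolyC n k : {mpoly R[n]}) - \sum_(i < n) mpolyX R (mnm1 i) ^+ 2).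
Proof.
move=> N_ge0 psi_ball; pose C : {rmorphism R -> {mpoly R[n]}} := @mpolyC n R.
set Y2 := \sum_(i < n) _; pose u := C N - Y2.
have S_pre := sum_of_squares_preordering {mpoly R[n]}.
set T := adjoin _ psi; have T_pre : preordering T by apply: preordering_adjoin.
have TD := preorderingD T_pre; have TM := preorderingM T_pre.
have T_qm := preordering_quadratic_module T_pre.
(* Without this certificate a prime cone would contain [psi] and [- u], and its Artin-Lang point
   would satisfy [psi >= 0] outside the ball. *)
have [[q [p [Tq Tp e]]]|no_cert] := pselect (adjoin T (- u) (-1)); last first.
  have [P [Pc TP]] := preordering_prime_cone (preordering_adjoin (- u) T_pre) no_cert.
  have [|v vP] := @prime_cone_point R n P [:: psi; - u] Pc.
    move=> f; rewrite !inE => /orP[]/eqP->; apply: TP; last exact: adjoin_self.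
    by apply: sub_adjoin => //; apply: adjoin_self.
  have := psi_ball v (vP psi (mem_head _ _)); rewrite ltNge => /negP[].
  have := vP (- u); rewrite !inE eqxx orbT => /(_ isT).
  have -> : meval v (- u) = \sum_(i < n) v i ^+ 2 - N.
    rewrite mevalN mevalB mevalC opprB; congr (_ - _); rewrite /Y2.
    rewrite (raddf_sum (meval v)); apply: eq_bigr => i _.
    by rewrite /= expr2 mevalM mevalXU.
  by rewrite subr_ge0.
have {}e : p * u = 1 + q.
  have -> : p * u = q - (q + p * - u) by ring.
  by rewrite -e; ring.
pose T' := adjoin T u.
have T'_pre : preordering T' by apply: preordering_adjoin.
(* The factor [1 + q = p * u] turns [s' * u] into [p * s' * u ^ 2], which lies in [T]. *)
have T'_mul t : T' t -> T ((1 + q) * t).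
  move=> [s [s' [Ts Ts' ->]]].
  rewrite (_ : _ * _ = s + q * s + p * s' * u ^+ 2).
    apply: (TD); first by apply: (TD) => //; apply: (TM).
    by apply: (TM); [apply: (TM)|apply: preordering_sqr].
  have -> : (1 + q) * (s + s' * u) = s + q * s + (1 + q) * (s' * u) by ring.
  by rewrite -e; ring.
have [m [+ _]] : module_bounded T' q.
  apply: (@module_bounded_ball _ _ _ _ N); first exact: preordering_quadratic_module.
  exact: adjoin_self.
move=> /T'_mul Tmq.
(* The added square cancels the terms [m * q] and [- q ^ 2] of [(1 + q) * (m - q)], leaving a
   constant bound on [q] modulo [T]. *)
have Tc : T (C (m + m ^+ 2 / 4) - q).
  rewrite (_ : _ - q = (1 + q) * (C m - q) + (q - C (m / 2)) ^+ 2).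
    by apply: (TD) => //; apply: preordering_sqr.
  rewrite rmorphD (_ : m ^+ 2 / 4 = (m / 2) ^+ 2); last by field.
  rewrite rmorphXn; have -> : C m = C 2 * C (m / 2).
    by rewrite -rmorphM (_ : 2 * (m / 2) = m) //; field.
  by rewrite rmorph_nat; ring.
(* Adding [q * Y2] to [(1 + q) * u] gives [N + N * q - Y2], and the bound on [q] replaces [N * q] by
   a constant. *)
exists (N + N * (m + m ^+ 2 / 4)).
have TY2 : T Y2.
  apply: quadratic_module_sum => // i _; exact: preordering_sqr.
rewrite (_ : _ - Y2 = (1 + q) * u + q * Y2 + C N * (C (m + m ^+ 2 / 4) - q)).
  apply: (TD); last exact: quadratic_module_const.
  by apply: (TD); [apply/T'_mul/adjoin_self|apply: (TM)].
by rewrite -[mpolyC n _]/(C _) rmorphD rmorphM /u; ring.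
Qed.

(** * The Positivstellensatz for Archimedean quadratic modules *)

Section PositivePolynomials.
Variables (R : realType) (n : nat).
Implicit Types (M : set {mpoly R[n]}) (p q f : {mpoly R[n]}).

Let C : {rmorphism R -> {mpoly R[n]}} := @mpolyC n R.

Lemma maximal_quadratic_module M : quadratic_module M -> ~ M (-1) ->
  exists P, [/\ quadratic_module P, ~ P (-1), M `<=` P & forall x, P x \/ P (- x)].
Proof.
move=> M_qm M_N1.
have [|F [A FA] FP Ftot|P [[P_qm P_N1] MP P_max]] :=
    @Zorn_above _ [set P | quadratic_module P /\ ~ P (-1)] M; first by [].
  have F2 := chain_bigcup2 Ftot.
  split; last by move=> [X FX X_N1]; have [_] := FP X FX.
  split.
  - move=> x y Fx Fy; have [X [FX Xx Xy]] := F2 x y Fx Fy.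
    by exists X => //; apply: (quadratic_moduleD (FP X FX).1).
  - by exists A => //; apply: quadratic_module1 (FP A FA).1.
  - by move=> x y [X FX Xy]; exists X => //; apply: quadratic_module_sqr (FP X FX).1 _ _ Xy.
exists P; split=> // x.
have PD := quadratic_moduleD P_qm.
have P_gen y : ~ P y -> exists m s, [/\ P m, sum_of_squares s & - s * y = 1 + m].
  move=> nPy; have D_qm := quadratic_module_adjoin P_qm y.
  have [[m [s [Pm ss e]]]|D_N1] := pselect (qm_adjoin P y (-1)); last first.
    case: nPy; apply: (P_max (qm_adjoin P y)) => //; first exact: sub_qm_adjoin.
    exact: qm_adjoin_self.
  exists m, s; split=> //.
  have -> : - s * y = m - (m + s * y) by ring.
  by rewrite -e; ring.
apply: contrapT => /not_orP[/P_gen[m [s [Pm ss e]]] /P_gen[m' [s' [Pm' ss' e']]]].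
(* Instead of a product of elements of [P], the relation [s' * (1 + m) + s * (1 + m') = 0] is
   used. *)
have PNs : P (- s).
  rewrite (_ : - s = s' + (s' * m + s * m')).
    apply: (PD); first exact: sos_quadratic_module.
    by apply: (PD); apply: quadratic_module_sos.
  have -> : m = - s * x - 1 by rewrite e; ring.
  have -> : m' = - s' * - x - 1 by rewrite e'; ring.
  by ring.
have Ps : P s by apply: sos_quadratic_module.
(* [P] and [- P] meet in an ideal since [x] is a difference of squares. *)
have Psx : P (s * x).
  rewrite (_ : s * x = (C (2^-1) * (x + 1)) ^+ 2 * s + (C (2^-1) * (x - 1)) ^+ 2 * - s).
    by apply: (PD); apply: quadratic_module_sqr.
  rewrite (_ : _ + _ = (C (2^-1) * C 2) ^+ 2 * (s * x)); last by rewrite rmorph_nat; ring.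
  by rewrite -rmorphM mulVf ?pnatr_eq0 // rmorph1 expr1n mul1r.
apply: P_N1; rewrite (_ : -1 = m + s * x); first exact: (PD).
by rewrite -[m](addKr 1) -e; ring.
Qed.

(** [c] is the value of [p] at the point described by [P]: their difference is infinitesimal for the
    order that [P] defines. *)
Let approx (P : set {mpoly R[n]}) p (c : R) := forall e, 0 < e ->
  P (C e + (p - C c)) /\ P (C e - (p - C c)).

Section Approximation.
Variable P : set {mpoly R[n]}.
Hypothesis P_qm : quadratic_module P.
Let PD := quadratic_moduleD P_qm.

Let approxC c : approx P (C c) c.
Proof. by move=> e /ltW e_ge0; rewrite subrr addr0 subr0; split; apply: quadratic_module_ge0. Qed.

Let approxD p q c d : approx P p c -> approx P q d -> approx P (p + q) (c + d).
Proof.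
move=> pc qd e e_gt0; have e2_gt0 : 0 < e / 2 by rewrite divr_gt0.
have [p1 p2] := pc _ e2_gt0; have [q1 q2] := qd _ e2_gt0.
have -> : C e = C (e / 2) + C (e / 2) by rewrite -rmorphD -splitr.
split; [have := PD p1 q1|have := PD p2 q2]; congr P; rewrite rmorphD; ring.
Qed.

Let approxZ a p c : approx P p c -> approx P (C a * p) (a * c).
Proof.
move=> pc e e_gt0; have k_gt0 : 0 < `|a| + 1 by rewrite ltr_wpDl.
(* Dividing by [|a| + 1] rather than [|a|] covers the case [a = 0]. *)
have [d d_gt0 ->] : exists2 d, 0 < d & e = `|a| * d + d.
  by exists (e / (`|a| + 1)); [rewrite divr_gt0|field; rewrite gt_eqF].
have [p1 p2] := pc d d_gt0.
have Pd : P (C d) by apply: quadratic_module_ge0 => //; apply: ltW.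
rewrite rmorphD !rmorphM.
have [a_ge0|a_lt0] := lerP 0 a.
  rewrite ger0_norm //; split; [have := PD (quadratic_module_const P_qm a_ge0 p1) Pd
         |have := PD (quadratic_module_const P_qm a_ge0 p2) Pd]; congr P; ring.
have Na_ge0 : 0 <= - a by rewrite oppr_ge0 ltW.
rewrite ltr0_norm //; split; [have := PD (quadratic_module_const P_qm Na_ge0 p2) Pd
       |have := PD (quadratic_module_const P_qm Na_ge0 p1) Pd];
  congr P; rewrite !rmorphN; ring.
Qed.

Let approx_sqr0 p : approx P p 0 -> approx P (p ^+ 2) 0.
Proof.
move=> p0 e e_gt0; rewrite rmorph0 subr0; split.
  apply: (PD); first by apply: quadratic_module_ge0 => //; apply: ltW.
  by apply: sos_quadratic_module => //; apply: preordering_sqr; apply: sum_of_squares_preordering.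
have s_gt0 : 0 < Num.sqrt e by rewrite sqrtr_gt0.
have := p0 _ s_gt0; rewrite rmorph0 subr0 => -[p1 p2].
by have := quadratic_module_sqr_bound P_qm s_gt0 p2 p1; rewrite sqr_sqrtr // ltW.
Qed.

Let approx_sqr p c : approx P p c -> approx P (p ^+ 2) (c ^+ 2).
Proof.
move=> pc; have p0 : approx P (p - C c) 0.
  have := approxD pc (approxC (- c)); rewrite subrr.
  by rewrite rmorphN.
have -> : p ^+ 2 = (p - C c) ^+ 2 + (C (2 * c) * (p - C c) + C (c ^+ 2)).
  by rewrite rmorphM rmorphXn rmorph_nat; ring.
have := approxD (approx_sqr0 p0) (approxD (approxZ (2 * c) p0) (approxC (c ^+ 2))).
by rewrite mulr0 !add0r.
Qed.

Let approxM p q c d : approx P p c -> approx P q d -> approx P (p * q) (c * d).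
Proof.
move=> pc qd.
have -> : p * q = C (4^-1) * ((p + q) ^+ 2 + C (-1) * (p + C (-1) * q) ^+ 2).
  have -> : (p + q) ^+ 2 + C (-1) * (p + C (-1) * q) ^+ 2 = C 4 * (p * q).
    by rewrite rmorphN rmorph1 rmorph_nat; ring.
  by rewrite mulrA -rmorphM mulVf ?pnatr_eq0 // rmorph1 mul1r.
have -> : c * d = 4^-1 * ((c + d) ^+ 2 + (-1) * (c + (-1) * d) ^+ 2) by field.
by do ?[exact: pc|exact: qd|apply: approxZ|apply: approxD|apply: approx_sqr].
Qed.

Let approx_ge0 p c : ~ P (-1) -> P p -> approx P p c -> 0 <= c.
Proof.
move=> P_N1 Pp pc; rewrite leNgt; apply/negP => c_lt0; apply: P_N1.
have Nc_gt0 : 0 < - c / 2 by rewrite divr_gt0 // oppr_gt0.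
have [_ /(PD Pp)] := pc _ Nc_gt0.
have -> : p + (C (- c / 2) - (p - C c)) = C (c / 2).
  rewrite (_ : C (c / 2) = C (- c / 2) + C c); first by ring.
  by rewrite -rmorphD; congr mpolyC; field.
have : 0 <= - (c / 2)^-1 by rewrite oppr_ge0 invr_le0 pmulr_lle0 ?invr_gt0 // ltW.
move=> /(quadratic_module_const P_qm) h /h.
by rewrite -rmorphM mulNr mulVf ?rmorphN ?rmorph1 // mulf_neq0 ?invr_eq0 ?pnatr_eq0 // lt_eqF.
Qed.

(** The value is a cut: the supremum of the [r] with [p - r] in [P], totality of [P] giving the
    bound from above. *)
Let approx_exists p : ~ P (-1) -> (forall x, P x \/ P (- x)) -> module_bounded P p ->
  exists c, approx P p c.
Proof.
move=> P_N1 P_total [k [km kp]].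
have P_ge0 (c : R) : P (C c) -> 0 <= c.
  by move=> Pc; apply: approx_ge0 Pc (approxC c).
pose S := [set r | P (p - C r)].
have supS : has_sup S.
  split; first by exists (- k); rewrite /S /= rmorphN opprK addrC.
  exists k => r Sr; rewrite -subr_ge0; apply: P_ge0.
  by have := PD km Sr; congr P; rewrite rmorphB; ring.
exists (sup S) => e e_gt0; split.
  have [r Sr lt_r] := sup_adherent e_gt0 supS.
  have := PD Sr (quadratic_module_ge0 P_qm (_ : 0 <= r - (sup S - e))).
  rewrite subr_ge0 ltW // => /(_ isT); congr P; rewrite !rmorphB; ring.
have [Pe|] := P_total (p - C (sup S + e)).
  by have := ub_le_sup supS.2 Pe; rewrite gerDl leNgt e_gt0.
by congr P; rewrite rmorphD; ring.
Qed.

Let approx_eval v : (forall i : 'I_n, approx P (mpolyX R (mnm1 i)) (v i)) ->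
  forall p, approx P p (meval v p).
Proof.
move=> vX p; rewrite mevalE [p in approx P p]mpolyE.
elim: (msupp p) => [|m s IHs]; first by rewrite !big_nil -(rmorph0 C); apply: approxC.
rewrite !big_cons; apply: approxD => //; rewrite -mul_mpolyC; apply: approxM.
  exact: approxC.
rewrite -mmap1_id /mmap1.
elim: (index_enum 'I_n) => [|i r IHr]; first by rewrite !big_nil -(rmorph1 C); apply: approxC.
rewrite !big_cons; apply: approxM => //.
elim: (m i) => [|k IHk]; first by rewrite !expr0 -(rmorph1 C); apply: approxC.
by rewrite !exprS; apply: approxM.
Qed.

(** The coordinates of [v] are the values of the variables. Values respect sums and products, so
    that of [f] is [meval v f]. *)
Lemma archimedean_point : ~ P (-1) -> (forall x, P x \/ P (- x)) ->
    (forall p, module_bounded P p) ->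
  exists v : 'I_n -> R, forall f, P f -> 0 <= meval v f.
Proof.
move=> P_N1 P_total P_arch.
have [v vX] := choice (fun i : 'I_n => approx_exists P_N1 P_total (P_arch (mpolyX R (mnm1 i)))).
by exists v => f Pf; apply: approx_ge0 Pf (approx_eval vX f).
Qed.

End Approximation.

(** Lowers the constant added to [f] by [k ^- 2], an amount independent of [r], through an identity
    for [k ^ 2 * (f + r) - 1]. *)
Lemma putinar_step M (k : R) f s m r : quadratic_module M -> 0 < k -> 0 <= r ->
    sum_of_squares s -> s * f = 1 + m -> M m ->
    M (C (2 * k) - s) -> M (C (2 * k - 1) - s ^+ 2 * f) -> M (f + C r) ->
  M (f + C (r - k ^- 2)).
Proof.
move=> M_qm k_gt0 r_ge0 ss e Mm Mks Mkf Mfr.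
have MD := quadratic_moduleD M_qm; have k_neq0 := lt0r_neq0 k_gt0.
have -> : f + C (r - k ^- 2) = C (k ^- 2) * (C (k ^+ 2) * (f + C r) - 1).
  rewrite mulrBr mulrA -rmorphM mulVf ?expf_neq0 // rmorph1 mul1r mulr1.
  by rewrite rmorphB; ring.
apply: quadratic_module_const => //; first by rewrite invr_ge0 sqr_ge0.
have -> : C (k ^+ 2) * (f + C r) - 1 = (C k - s) ^+ 2 * (f + C r) + C (2 * k) * m +
    C r * (s * (C (2 * k) - s)) + (C (2 * k - 1) - s ^+ 2 * f).
  have -> : m = s * f - 1 by rewrite e; ring.
  by rewrite rmorphB rmorphXn rmorphM rmorph1 rmorph_nat; ring.
apply: (MD) => //; apply: (MD); first apply: (MD).
- exact: quadratic_module_sqr.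
- by apply: quadratic_module_const => //; rewrite mulr_ge0 // ltW.
apply: quadratic_module_const => //.
have -> : s * (C (2 * k) - s) =
    C ((2 * k)^-1) * ((C (2 * k) - s) ^+ 2 * s + s ^+ 2 * (C (2 * k) - s)).
  have -> : (C (2 * k) - s) ^+ 2 * s + s ^+ 2 * (C (2 * k) - s) =
      C (2 * k) * (s * (C (2 * k) - s)) by ring.
  by rewrite mulrA -rmorphM mulVf ?rmorph1 ?mul1r // mulf_neq0 ?pnatr_eq0.
apply: quadratic_module_const => //; first by rewrite invr_ge0 mulr_ge0 // ltW.
apply: (MD); apply: quadratic_module_sqr => //; exact: sos_quadratic_module.
Qed.

(** Unless [s * f = 1 + m] for some [s] and [m], a maximal proper module containing [- f] gives a
    point with [f <= 0]. From this identity, [putinar_step] lowers a constant [r] with [f + r] in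
    [M] until it is negative. *)
Lemma archimedean_positivstellensatz M f : quadratic_module M ->
    (forall p, module_bounded M p) ->
    (forall v : 'I_n -> R, (forall q, M q -> 0 <= meval v q) -> 0 < meval v f) ->
  M f.
Proof.
move=> M_qm M_arch f_gt0; have MD := quadratic_moduleD M_qm.
have [[m [s [Mm ss e]]]|D_N1] := pselect (qm_adjoin M (- f) (-1)); last first.
  have [P [P_qm P_N1 DP P_total]] :=
    maximal_quadratic_module (quadratic_module_adjoin M_qm (- f)) D_N1.
  have MP : M `<=` P by move=> q Mq; apply: DP; apply: sub_qm_adjoin.
  have [|v vP] := archimedean_point P_qm P_N1 P_total.
    by move=> p; have [k [km kp]] := M_arch p; exists k; split; apply: MP.
  have := vP (- f) (DP _ (qm_adjoin_self M_qm _)); rewrite mevalN oppr_ge0 leNgt.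
  by rewrite f_gt0 // => q /MP/vP.
have sf : s * f = 1 + m.
  have -> : s * f = m - (m + s * - f) by ring.
  by rewrite -e; ring.
have [k1 [k1_gt0 Mk1 _]] := module_bounded_pos M_qm (M_arch s).
have [k2 [k2_gt0 Mk2 _]] := module_bounded_pos M_qm (M_arch (s ^+ 2 * f)).
have [r0 [_ Mr0]] := M_arch f.
pose k := k1 + k2 + 1; have k_gt0 : 0 < k by rewrite !addr_gt0.
have Mks : M (C (2 * k) - s).
  have -> : C (2 * k) - s = C (2 * k - k1) + (C k1 - s) by rewrite rmorphB; ring.
  by apply: (MD) => //; apply: quadratic_module_ge0; rewrite // /k; lra.
have Mkf : M (C (2 * k - 1) - s ^+ 2 * f).
  have -> : C (2 * k - 1) - s ^+ 2 * f = C (2 * k - 1 - k2) + (C k2 - s ^+ 2 * f).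
    by rewrite [C (_ - k2)]rmorphB; ring.
  by apply: (MD) => //; apply: quadratic_module_ge0; rewrite // /k; lra.
have neg r : r < 0 -> M (f + C r) -> M f.
  move=> r_lt0 Mr; rewrite -[f](addrK (C r)) -rmorphN.
  by apply: (MD) => //; apply: quadratic_module_ge0; rewrite // oppr_ge0 ltW.
have step j : M f \/ M (f + C (r0 - j%:R * k ^- 2)).
  elim: j => [|j [Mf|Mj]]; [by right; rewrite mul0r subr0 addrC|by left|].
  have [r_ge0|r_lt0] := lerP 0 (r0 - j%:R * k ^- 2).
    right; have := putinar_step M_qm k_gt0 r_ge0 ss sf Mm Mks Mkf Mj.
    by congr (M (f + C _)); rewrite -natr1; ring.
  by left; apply: neg Mj.
(* More than [|r0| * k ^ 2] steps of length [k ^- 2] make the constant negative. *)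
have [//|] := step (Num.bound (`|r0| * k ^+ 2)).
apply: neg; rewrite subr_lt0 (le_lt_trans (ler_norm _)) //.
by rewrite ltr_pdivlMr ?exprn_gt0 // archi_boundP // mulr_ge0 // sqr_ge0.
Qed.

End PositivePolynomials.

(** * Putinar's theorem and truncations *)

Section Putinar.
Variables (R : realType) (n s : nat) (g : 'I_s -> {mpoly R[n]}).
Implicit Types (p f : {mpoly R[n]}) (y : 'rV[R]_n).

Lemma quadratic_module_quad_module : quadratic_module (quad_module g).
Proof.
have sosP := sum_of_squares_preordering {mpoly R[n]}.
split.
- move=> _ _ [s0 [sg [s0P sgP ->]]] [t0 [tg [t0P tgP ->]]].
  exists (s0 + t0), (fun j => sg j + tg j); split.
  + exact: (preorderingD sosP s0P t0P).
  + by move=> j; apply: (preorderingD sosP (sgP j) (tgP j)).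
  + rewrite addrACA -big_split; congr (_ + _).
    by apply: eq_bigr => j _; rewrite mulrDl.
- exists 1, (fun=> 0); split; first exact: (preordering1 sosP).
    by move=> j; apply: (preordering0 sosP).
  by rewrite big1 ?addr0 // => j _; rewrite mul0r.
- move=> x _ [s0 [sg [s0P sgP ->]]].
  exists (x ^+ 2 * s0), (fun j => x ^+ 2 * sg j); split.
  + exact: (preorderingM sosP (preordering_sqr sosP x) s0P).
  + by move=> j; apply: (preorderingM sosP (preordering_sqr sosP x) (sgP j)).
  + by rewrite mulrDr mulr_sumr; congr (_ + _); apply: eq_bigr => j _; rewrite mulrA.
Qed.

Lemma quad_module_gen j : quad_module g (g j).
Proof.
have sosP := sum_of_squares_preordering {mpoly R[n]}.
exists 0, (fun i => if i == j then 1 else 0); split; first exact: (preordering0 sosP).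
  by move=> i; case: ifP => _; [apply: (preordering1 sosP)|apply: (preordering0 sosP)].
by rewrite add0r (bigD1 j) //= eqxx mul1r big1 ?addr0 // => i /negPf->; rewrite mul0r.
Qed.

Lemma peval_row (v : 'I_n -> R) p : peval p (\row_i v i) = meval v p.
Proof. by apply: meval_eq => i; rewrite mxE. Qed.

(** The preordering generated by the single [psi] consists of the [s0 + s1 * psi], so it lies in
    [quad_module g], which thereby contains a ball polynomial. *)
Lemma archimedean_module_bounded :
  archimedean_module g -> forall p, module_bounded (quad_module g) p.
Proof.
move=> [psi Qpsi /compact_bounded[M [Mreal M_bound]]].
have Q_qm := quadratic_module_quad_module.
(* [M_bound] concerns bounds above [M], which may be negative. The norm is the maximum norm, hence
   the factor [n]; the last [1] makes the inequality strict. *)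
pose K := `|M| + 1; pose N := n%:R * K ^+ 2 + 1.
have K_gt0 : 0 < K by rewrite ltr_wpDl.
have [k ball] : exists k : R, adjoin (@sum_of_squares {mpoly R[n]}) psi
    ((mpolyC n k : {mpoly R[n]}) - \sum_(i < n) mpolyX R (mnm1 i) ^+ 2).
  apply: (@preordering_ball R n psi N); first by rewrite addr_ge0 // mulr_ge0 // sqr_ge0.
  move=> v v_ge0; rewrite /N ltr_pwDr //.
  have v_bound i : v i ^+ 2 <= K ^+ 2.
    rewrite -real_normK ?num_real // ler_sqr ?nnegrE ?(ltW K_gt0) //.
    have le_K : `|\row_i v i : 'rV[R]_n| <= K.
      apply: M_bound; last by rewrite /= peval_row.
      by rewrite /K (le_lt_trans (ler_norm M)) // ltrDl.
    have -> : v i = (\row_i v i) ord0 i by rewrite mxE.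
    apply: le_trans le_K.
    by rewrite [leRHS]/Num.norm /= mx_normrE; apply/bigmax_geP; right; exists (ord0, i).
  by apply: le_trans (ler_sum _ (fun i _ => v_bound i)) _; rewrite sumr_const card_ord mulr_natl.
apply: (module_bounded_ball Q_qm (N := k)); have [s0 [s1 [s0P s1P ->]]] := ball.
apply: (quadratic_moduleD Q_qm); first exact: sos_quadratic_module.
exact: quadratic_module_sos.
Qed.

Lemma putinar f : archimedean_module g ->
  (forall y, semialg g y -> 0 < peval f y) -> quad_module g f.
Proof.
move=> /archimedean_module_bounded Q_arch f_gt0.
apply: archimedean_positivstellensatz => //; first exact: quadratic_module_quad_module.
move=> v v_ge0; rewrite -peval_row; apply: f_gt0 => j.
by rewrite peval_row; apply: v_ge0; apply: quad_module_gen.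
Qed.

Lemma trunc_quad_module_mono k l : (k <= l)%N ->
  trunc_quad_module g k `<=` trunc_quad_module g l.
Proof.
move=> kl p [s0 [sg [[s0P s0k] sgP ->]]]; have kl2 : (k.*2 <= l.*2)%N by rewrite leq_double.
exists s0, sg; split=> //; first by split=> //; apply: leq_trans kl2.
by move=> j; have [sgj sgk] := sgP j; split=> //; apply: leq_trans kl2.
Qed.

Lemma trunc_quad_module_sub k : trunc_quad_module g k `<=` quad_module g.
Proof. by move=> p [s0 [sg [[s0P _] sgP ->]]]; exists s0, sg; split=> // j; have [] := sgP j. Qed.

Lemma quad_module_trunc p : quad_module g p -> exists k, trunc_quad_module g k p.
Proof.
move=> [s0 [sg [s0P sgP ->]]].
exists (maxn (pdeg s0) (\max_(j < s) pdeg (sg j * g j)%R)), s0, sg; split=> //.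
  by split=> //; rewrite -addnn; apply: leq_trans (leq_addr _ _); apply: leq_maxl.
move=> j; split=> //; rewrite -addnn; apply: leq_trans (leq_addr _ _).
by apply: leq_trans (leq_maxr _ _); apply: leq_bigmax.
Qed.

Lemma quad_module_ge0 p y : quad_module g p -> semialg g y -> 0 <= peval p y.
Proof.
have sos_ge0 q : is_sos q -> 0 <= peval q y.
  move=> [qs ->]; rewrite /peval (raddf_sum (meval _)); apply: sumr_ge0 => r _.
  by rewrite /= expr2 mevalM -expr2 sqr_ge0.
move=> [s0 [sg [s0P sgP ->]]] Sy; rewrite /peval mevalD (raddf_sum (meval _)).
apply: addr_ge0; first exact: sos_ge0.
by apply: sumr_ge0 => j _; rewrite /= mevalM mulr_ge0 //; [apply: sos_ge0|apply: Sy].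
Qed.

End Putinar.

(** * Convergence of the hierarchy *)

Lemma peval_constraint_poly (R : realType) (m n : nat) (a : 'I_m -> {mpoly R[n]})
    (b : {mpoly R[n]}) x y :
  peval (constraint_poly a b x) y = constraint_val a b x y.
Proof.
rewrite /peval /constraint_poly mevalD (raddf_sum (meval _)); congr (_ + _).
by apply: eq_bigr => i _; rewrite /= mevalZ mulrC.
Qed.

Lemma constraint_val_conv (R : realType) (m n : nat) (a : 'I_m -> {mpoly R[n]})
    (b : {mpoly R[n]}) (t : R) x x' y :
  constraint_val a b (t *: x + (1 - t) *: x') y =
  t * constraint_val a b x y + (1 - t) * constraint_val a b x' y.
Proof.
rewrite /constraint_val; set A := \sum_(i < m) _.
have -> : A = t * (\sum_(i < m) peval (a i) y * x ord0 i) +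
    (1 - t) * (\sum_(i < m) peval (a i) y * x' ord0 i).
  by rewrite !mulr_sumr -big_split; apply: eq_bigr => i _; rewrite !mxE /=; ring.
by ring.
Qed.

Unset Implicit Arguments.

Theorem theorem4p5 (R : realType) (m n s : nat)
    (h : {mpoly R[m]}) (a : 'I_m -> {mpoly R[n]}) (b : {mpoly R[n]})
    (g : 'I_s -> {mpoly R[n]})
    (h_convex : convex_function [set: 'rV[R]_m] (peval h))
    (g_arch : archimedean_module g)
    (Slater : slater a b g) :
  (forall k l : nat, (d_P a b g <= k)%N -> (k <= l)%N ->
     (h_sos h a b g l <= h_sos h a b g k)%E) /\
  (h_sos h a b g k @[k --> \oo] --> h_star h a b g).
Proof.
have mono k l : (k <= l)%N -> (h_sos h a b g l <= h_sos h a b g k)%E.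
  move=> kl; apply: ereal_inf_le_tmp => _ [x xk <-]; exists x => //.
  exact: trunc_quad_module_mono xk.
split=> [k l _|]; first exact: mono.
(* A non-increasing sequence tends to its infimum. *)
suff -> : h_star h a b g = ereal_inf (range (h_sos h a b g)).
  exact: ereal_nonincreasing_cvgn.
apply/eqP; rewrite eq_le; apply/andP; split.
  apply: le_ereal_inf_tmp => _ [k _ <-]; apply: ereal_inf_le_tmp => _ [x xk <-].
  exists x => // y Sy; rewrite -peval_constraint_poly.
  exact: quad_module_ge0 (trunc_quad_module_sub xk) Sy.
apply: le_ereal_inf_tmp => _ [x x_feas <-]; apply/lee_addgt0Pr => e e_gt0.
have [xbar xbarP] := Slater.
(* This [t] is positive even if [D = 0], which makes the constraint at [xt] positive on [S], and it
   keeps the loss [t * D] in the objective below [e]. *)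
pose D := peval h xbar - peval h x; pose t := e / (e + `|D|).
have eD_gt0 : 0 < e + `|D| by rewrite ltr_pwDl.
have t_gt0 : 0 < t by rewrite divr_gt0.
have t_le1 : t <= 1 by rewrite ler_pdivrMr // mul1r lerDl.
have tD : t * D <= e.
  apply: (le_trans (ler_wpM2l (ltW t_gt0) (ler_norm D))).
  by rewrite /t mulrAC ler_pdivrMr // ler_wpM2l ?(ltW e_gt0) // lerDr ltW.
pose xt := t *: xbar + (1 - t) *: x.
have [k xtk] : exists k, trunc_quad_module g k (constraint_poly a b xt).
  apply/quad_module_trunc/putinar => // y Sy.
  rewrite peval_constraint_poly constraint_val_conv; apply: ltr_wpDr.
    by rewrite mulr_ge0 ?subr_ge0 // x_feas.
  by apply: mulr_gt0 => //; apply: xbarP.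
have h_xt : peval h xt <= peval h x + e.
  have := h_convex (Itv01 (ltW t_gt0) t_le1) xbar x (in_setT _) (in_setT _).
  rewrite convRE /= => /le_trans; apply.
  have -> : t * peval h xbar + (1 - t) * peval h x = peval h x + t * D by rewrite /D; ring.
  by rewrite lerD2l.
have le_k : (h_sos h a b g k <= (peval h xt)%:E)%E by apply: ereal_inf_lbound; exists xt.
apply: (@le_trans _ _ (h_sos h a b g k)); first by apply: ereal_inf_lbound; exists k.
by apply: (le_trans le_k); rewrite -EFinD lee_fin.
Qed.
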